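(* Assume (A1)–(A5). Let $K$ be a fixed integer with $K>\max\{1,p\kappa_g^2/2\}$, run SLPMM with $\alpha=\sqrt K$ and $\sigma=1/\sqrt K$, and let $\bar x^K:=\frac1K\sum_{k=0}^{K-1}x^k$. Then for every $\rho\ge0$ and every $i=1,\dots,p$, $$\Pr\Big[g_i(\bar x^K)\le\frac{\theta_1\rho+\theta_2+\theta_3\log(K+1)}{\sqrt K}+\frac{\theta_4}{K}\Big]\ge1-\exp(-\rho^2/3)-\exp(-\rho).$$
   Context: Let $\mathcal C\subset\mathbb R^n$ be a nonempty compact convex set. Let $\xi$ be a random vector whose distribution is supported on $\Xi\subseteq\mathbb R^q$, and let $F:\mathcal C\times\Xi\to\mathbb R$ and $G_i:\mathcal C\times\Xi\to\mathbb R$ ($i=1,\dots,p$) be such that $F(\cdot,\xi)$, $G_i(\cdot,\xi)$ are convex and continuous on $\mathcal C$ for every $\xi$, and $f(x):=\mathbb E[F(x,\xi)]$, $g_i(x):=\mathbb E[G_i(x,\xi)]$ are finite on $\mathcal C$. Write $G=(G_1,\dots,G_p)^T$. Stochastic subgradients: $v_0(x,\xi)\in\partial_xF(x,\xi)$, $v_i(x,\xi)\in\partial_xG_i(x,\xi)$. $[t]_+=\max\{t,0\}$, $[t]_+^2=(\max\{t,0\})^2$. SLPMM: fix $\sigma,\alpha>0$, $x^0\in\mathcal C$, $\lambda^0=0\in\mathbb R^p$, i.i.d. copies $\xi^0,\xi^1,\dots$ of $\xi$. For $k\ge0$, $x^{k+1}=\arg\min_{x\in\mathcal C}\{\mathcal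 L^k_\sigma(x,\lambda^k)+\frac{\alpha}{2}\|x-x^k\|^2\}$ with $\mathcal L^k_\sigma(x,\lambda):=F(x^k,\xi^k)+\langle v_0(x^k,\xi^k),x-x^k\rangle+\frac{1}{2\sigma}[\sum_{i=1}^p[\lambda_i+\sigma(G_i(x^k,\xi^k)+\langle v_i(x^k,\xi^k),x-x^k\rangle)]_+^2-\|\lambda\|^2]$, and $\lambda_i^{k+1}=[\lambda_i^k+\sigma(G_i(x^k,\xi^k)+\langle v_i(x^k,\xi^k),x^{k+1}-x^k\rangle)]_+$. Assumptions: (A1) $\|x'-x''\|\le R$ on $\mathcal C$. (A2) $\|G(x,\xi)\|\le\nu_g$ for all $x\in\mathcal C,\xi\in\Xi$. (A3) $\|v_0(x,\xi)\|\le\kappa_f$, $\|v_i(x,\xi)\|\le\kappa_g$ for all $x,\xi$. (A4) (Slater) there exist $\varepsilon_0>0$ and $\hat x\in\mathcal C$ with $g_i(\hat x)\le-\varepsilon_0$ for all $i$. (A5) There is $\sigma_c>0$ with $\mathbb E[\exp(|G_i(x,\xi)-g_i(x)|^2/\sigma_c^2)]\le\exp(1)$ for all $x\in\mathcal C$, $i=1,\dots,p$. Constants: $\beta_0:=\nu_g+\sqrt p\,\kappa_gR$, $\kappa_0:=\frac{2\kappa_fR}{\varepsilon_0}$, $\kappa_1:=\frac{R^2}{\varepsilon_0}$, $\kappa_2:=\frac{\nu_g^2}{\varepsilon_0}-\beta_0$, $\kappa_3:=2\beta_0+\frac{\varepsilon_0}{2}+\frac{8\beta_0^2}{\varepsilon_0}\log\frac{32\beta_0^2}{\varepsilon_0^2}$;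 $\theta_1:=\sigma_c+(1+\sqrt p\,\kappa_g^2)\frac{16\beta_0}{\varepsilon_0}$, $\theta_2:=\kappa_g\kappa_f+(1+\sqrt p\,\kappa_g^2)(\kappa_0+\kappa_1+2\kappa_3)$, $\theta_3:=(1+\sqrt p\,\kappa_g^2)\frac{16\beta_0}{\varepsilon_0}$, $\theta_4:=\sqrt p\,\nu_g\kappa_g^2+(1+\sqrt p\,\kappa_g^2)\kappa_2$. *)

(* Defs.v *)
From HB Require Import structures.
From mathcomp Require Import all_boot all_order all_algebra.
From mathcomp Require Import all_classical all_reals all_analysis.

Set Implicit Arguments.
Unset Strict Implicit.
Unset Printing Implicit Defensive.

Import Order.TTheory GRing.Theory Num.Theory.
Import numFieldNormedType.Exports.

Local Open Scope classical_set_scope.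
Local Open Scope ring_scope.

Section SLPMM_defs.
Context {R : realType}.

Definition dotv (n : nat) (u w : 'rV[R]_n) : R := \sum_(j < n) u 0 j * w 0 j.
Definition enorm (n : nat) (u : 'rV[R]_n) : R := Num.sqrt (dotv u u).

Definition posp (t : R) : R := Num.max t 0.

Definition convex_on (n : nat) (C : set 'rV[R]_n) (h : 'rV[R]_n -> R) : Prop :=
  forall x y (t : R), C x -> C y -> 0 <= t <= 1 ->
    h (t *: x + (1 - t) *: y) <= t * h x + (1 - t) * h y.

Definition is_subgradient (n : nat) (C : set 'rV[R]_n) (h : 'rV[R]_n -> R)
  (x v : 'rV[R]_n) : Prop :=
  forall y, C y -> h x + dotv v (y - x) <= h y.

(* Expectation of a real random variable (finite by hypothesis where used). *)
Definition expect d (T : measurableType d) (P : probability T R) (X : T -> R) : R :=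
  fine (\int[P]_w (X w)%:E)%E.

Definition mutually_independent d (T : measurableType d) (P : probability T R)
  d' (X : measurableType d') (xs : nat -> T -> X) : Prop :=
  forall (s : seq nat) (A : nat -> set X), uniq s -> (forall k, measurable (A k)) ->
    P (\bigcap_(k in [set k | k \in s]) (xs k @^-1` A k)) =
    (\prod_(k <- s) P (xs k @^-1` A k))%E.

Definition identically_distributed d (T : measurableType d) (P : probability T R)
  d' (X : measurableType d') (xi : T -> X) (xs : nat -> T -> X) : Prop :=
  forall k (A : set X), measurable A -> P (xs k @^-1` A) = P (xi @^-1` A).

Definition natural_sigma d' (X : sigmaRingType d') (Omega : Type)
  (xs : nat -> Omega -> X) (k : nat) : set (set Omega) :=
  g_sigma_preimage (fun m : 'I_k => xs m).

Definition SLag (n p : nat) (sigma : R) (Fk : R) (v0k : 'rV[R]_n)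
  (Gk : 'I_p -> R) (vk : 'I_p -> 'rV[R]_n) (xk x : 'rV[R]_n) (lam : 'I_p -> R) : R :=
  Fk + dotv v0k (x - xk) +
  (\sum_(i < p) (posp (lam i + sigma * (Gk i + dotv (vk i) (x - xk)))) ^+ 2
   - \sum_(i < p) lam i ^+ 2) / (2 * sigma).

Definition beta0 (p : nat) (nu_g kappa_g Rd : R) : R :=
  nu_g + Num.sqrt p%:R * kappa_g * Rd.
Definition kappa0 (kappa_f Rd eps0 : R) : R := 2 * kappa_f * Rd / eps0.
Definition kappa1 (Rd eps0 : R) : R := Rd ^+ 2 / eps0.
Definition kappa2 (nu_g eps0 b0 : R) : R := nu_g ^+ 2 / eps0 - b0.
Definition kappa3 (b0 eps0 : R) : R :=
  2 * b0 + eps0 / 2 + 8 * b0 ^+ 2 / eps0 * ln (32 * b0 ^+ 2 / eps0 ^+ 2).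

Definition theta1 (p : nat) (kappa_g sigma_c b0 eps0 : R) : R :=
  sigma_c + (1 + Num.sqrt p%:R * kappa_g ^+ 2) * (16 * b0 / eps0).
Definition theta2 (p : nat) (kappa_f kappa_g Rd eps0 b0 : R) : R :=
  kappa_g * kappa_f + (1 + Num.sqrt p%:R * kappa_g ^+ 2) *
    (kappa0 kappa_f Rd eps0 + kappa1 Rd eps0 + 2 * kappa3 b0 eps0).
Definition theta3 (p : nat) (kappa_g b0 eps0 : R) : R :=
  (1 + Num.sqrt p%:R * kappa_g ^+ 2) * (16 * b0 / eps0).
Definition theta4 (p : nat) (nu_g kappa_g eps0 b0 : R) : R :=
  Num.sqrt p%:R * nu_g * kappa_g ^+ 2 +
  (1 + Num.sqrt p%:R * kappa_g ^+ 2) * kappa2 nu_g eps0 b0.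

End SLPMM_defs.

(* Main.v *)
Require Import Defs.
From HB Require Import structures.
From mathcomp Require Import all_boot all_order all_algebra.
From mathcomp Require Import all_classical all_reals all_analysis.
From mathcomp Require Import measurable_realfun.
From mathcomp Require Import ring lra.

(** Since alpha * sigma = 1, the three-point inequality of the proximal step shows that
    Phi_k = |lambda^k|^2 + |x^k - xhat|^2 satisfies, pathwise,
      Phi_(k+1) <= Phi_k + 2 sigma (c0 + sum_i lambda^k_i G_i(xhat, xi^k)),
    where by Slater's condition the sum has conditional mean at most
    - eps0 sum_i lambda^k_i. When sqrt Phi_k is large its increments are therefore
    dominated by a subgaussian variable with negative mean, and exp(theta sqrt Phi_k)
    grows by at most a constant in expectation at every step. Likewise, the exponential
    of the martingale sum_(j < k) (g_i(x^j) - G_i(x^j, xi^j)), suitably discounted, is a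
    supermartingale. A single Markov inequality bounds all the multipliers and this
    martingale, and summing the multiplier updates bounds g_i at the averaged iterate.
    Working with Phi_k directly, instead of with the drift of |lambda^k| over blocks of
    about sqrt K steps, leaves a large slack in kappa_3. All fluctuations are paid from
    it, and the failure probability is even at most exp(- rho). The multi-step drift
    lemma for |lambda^k| would need a factor of rho of order beta_0^2 / eps0, which
    16 beta_0 / eps0 does not dominate. *)

Import Order.TTheory GRing.Theory Num.Theory.
Import numFieldNormedType.Exports.

Local Open Scope classical_set_scope.
Local Open Scope ring_scope.

Set Implicit Arguments.
Unset Strict Implicit.
Unset Printing Implicit Defensive.

(** * Exponential and Euclidean inequalities *)

Lemma expR_le_inv1B (R : realType) (x : R) : x < 1 -> expR x <= (1 - x)^-1.
Proof.
move=> x1; have := expR_ge1Dx (- x); rewrite expRN => h.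
by rewrite -[leLHS]invrK lef_pV2 // posrE ?invr_gt0 ?expR_gt0 ?subr_gt0.
Qed.

(** The linear term is isolated so that it disappears on integrating against a centred variable,
    leaving only the exponential of a square. *)
Lemma expR_leD_expR_sqr (R : realType) (x : R) : expR x <= x + expR (2 * x ^+ 2).
Proof.
have h2 := expR_ge1Dx (2 * x ^+ 2).
have [x1|x1] := leP 1 x.
  have : expR x <= expR (2 * x ^+ 2) by rewrite ler_expR; nra.
  by lra.
suff : expR x <= 1 + x + 2 * x ^+ 2 by lra.
have [x0|x0] := leP x 0.
  apply: le_trans (expR_le_inv1B x1) _.
  rewrite -[leLHS]mul1r ler_pdivrMr ?subr_gt0 //.
  have : 0 <= x ^+ 2 * (1 - 2 * x) by apply: mulr_ge0; [exact: sqr_ge0|lra].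
  by nra.
have xh : x / 2 < 1 by lra.
(* The bound by [(1 - x)^-1] is too weak on [0 < x < 1]; applying it to [x / 2] and squaring is
   sharp enough. *)
have -> : expR x = expR (x / 2) ^+ 2.
  by rewrite expr2 -expRD; congr expR; field.
have h := expR_le_inv1B xh.
have : expR (x / 2) ^+ 2 <= ((1 - x / 2)^-1) ^+ 2.
  by rewrite ler_sqr ?nnegrE ?expR_ge0 // invr_ge0; lra.
move/le_trans; apply.
rewrite exprVn -[leLHS]mul1r ler_pdivrMr ?exprn_gt0 ?subr_gt0 //.
have : 0 <= x ^+ 2 * ((1 - x) * (5 / 4 - x / 2)).
  by apply: mulr_ge0; [exact: sqr_ge0|apply: mulr_ge0; lra].
by nra.
Qed.

Lemma expR_tangent (R : realType) (x y : R) : expR x * (1 + (y - x)) <= expR y.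
Proof.
have -> : expR y = expR x * expR (y - x) by rewrite -expRD; congr expR; ring.
by rewrite ler_pM2l ?expR_gt0 // expR_ge1Dx.
Qed.

(** Convexity of [expR] between 0 and [y - 1]. It is a pointwise form of Jensen's inequality for
    powers: if [expR y] has mean at most [expR 1], integrating the right side gives at most
    [expR s]. *)
Lemma expR_conv1 (R : realType) (s y : R) : 0 <= s <= 1 ->
  expR (s * y) <= expR s * (1 - s + s * expR (y - 1)).
Proof.
move=> /andP[s0 s1].
have -> : s * y = s + s * (y - 1) by ring.
rewrite expRD ler_pM2l ?expR_gt0 //.
set z := y - 1.
have h1 := expR_tangent (s * z) z.
have h2 : expR (s * z) * (1 - s * z) <= 1.
  by have := expR_tangent (s * z) 0; rewrite sub0r expR0.
have h3 : s * (expR (s * z) * (1 + (z - s * z))) <= s * expR z by exact: ler_wpM2l.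
have h4 : (1 - s) * (expR (s * z) * (1 - s * z)) <= 1 - s.
  by rewrite -[leRHS]mulr1 ler_wpM2l // subr_ge0.
by nra.
Qed.

Lemma expR_sum_conv (R : realType) (p : nat) (w x : 'I_p -> R) :
  (forall i, 0 <= w i) -> \sum_i w i = 1 ->
  expR (\sum_i w i * x i) <= \sum_i w i * expR (x i).
Proof.
move=> w0 w1; set m := \sum_i w i * x i.
have -> : expR m = \sum_i w i * (expR m * (1 + (x i - m))).
  transitivity (expR m * \sum_i (w i * (1 - m) + w i * x i)).
    by rewrite big_split /= -mulr_suml w1 -/m; ring.
  by rewrite mulr_sumr; apply: eq_bigr => i _; ring.
by apply: ler_sum => i _; apply: ler_wpM2l => //; exact: expR_tangent.
Qed.

Lemma sum_sqr_ge0 (R : realType) (p : nat) (a : 'I_p -> R) : 0 <= \sum_i a i ^+ 2.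
Proof. by apply: sumr_ge0 => i _; exact: sqr_ge0. Qed.

Lemma cauchy_schwarz_sum (R : realType) (p : nat) (a b : 'I_p -> R) :
  \sum_i a i * b i <= Num.sqrt (\sum_i a i ^+ 2) * Num.sqrt (\sum_i b i ^+ 2).
Proof.
set A := Num.sqrt _; set B := Num.sqrt _.
have A0 : 0 <= A by exact: sqrtr_ge0.
have B0 : 0 <= B by exact: sqrtr_ge0.
have A2 : \sum_i a i ^+ 2 = A ^+ 2 by rewrite sqr_sqrtr ?sum_sqr_ge0.
have B2 : \sum_i b i ^+ 2 = B ^+ 2 by rewrite sqr_sqrtr ?sum_sqr_ge0.
have z (u : 'I_p -> R) : \sum_i u i ^+ 2 = 0 -> forall i, u i = 0.
  move=> /eqP; rewrite psumr_eq0 => [/allP h i|i _]; last exact: sqr_ge0.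
  by have := h i (mem_index_enum i); rewrite sqrf_eq0 => /eqP.
have [A00|A1] := eqVneq A 0.
  rewrite big1 ?mulr_ge0 // => i _; rewrite (z a) ?mul0r //.
  by rewrite A2 A00 expr0n.
have [B00|B1] := eqVneq B 0.
  rewrite big1 ?mulr_ge0 // => i _; rewrite (z b) ?mulr0 //.
  by rewrite B2 B00 expr0n.
have : 0 <= \sum_i (B * a i - A * b i) ^+ 2 by exact: sum_sqr_ge0.
have -> : \sum_i (B * a i - A * b i) ^+ 2 =
  B ^+ 2 * A ^+ 2 + A ^+ 2 * B ^+ 2 - 2 * A * B * \sum_i a i * b i.
  rewrite -{1}A2 -{2}B2 !mulr_sumr -big_split /= -sumrB; apply: eq_bigr => i _.
  by ring.
have AB : 0 < A * B by rewrite mulr_gt0 // lt0r ?A1 ?B1.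
set s := \sum_i _ => h.
have : 0 <= (A * B) * (A * B - s) by nra.
by rewrite pmulr_rge0 // subr_ge0.
Qed.

Lemma minkowski_sum (R : realType) (p : nat) (a b : 'I_p -> R) :
  Num.sqrt (\sum_i (a i + b i) ^+ 2) <=
  Num.sqrt (\sum_i a i ^+ 2) + Num.sqrt (\sum_i b i ^+ 2).
Proof.
have h := cauchy_schwarz_sum a b.
have A2 := sqr_sqrtr (sum_sqr_ge0 a); have B2 := sqr_sqrtr (sum_sqr_ge0 b).
move: h A2 B2; set A := Num.sqrt _; set B := Num.sqrt _ => h A2 B2.
have A0 : 0 <= A by exact: sqrtr_ge0.
have B0 : 0 <= B by exact: sqrtr_ge0.
rewrite -[leRHS]ger0_norm ?addr_ge0 // -sqrtr_sqr ler_sqrt ?sqr_ge0 //.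
have -> : \sum_i (a i + b i) ^+ 2 =
  \sum_i a i ^+ 2 + 2 * (\sum_i a i * b i) + \sum_i b i ^+ 2.
  by rewrite mulr_sumr -!big_split /=; apply: eq_bigr => i _; ring.
by rewrite -A2 -B2; nra.
Qed.

Lemma ln32_ge3 (R : realType) : 3 <= ln (32 : R).
Proof.
rewrite -ler_expR lnK ?posrE //.
have h : expR (4^-1 : R) <= 4 / 3.
  have -> : 4 / 3 = (1 - 4^-1)^-1 :> R by field.
  by apply: expR_le_inv1B; lra.
(* [(4 / 3) ^+ 12] is about 31.6, just below 32; a coarser subdivision of 3 with the same bound
   would exceed it. *)
have -> : expR (3 : R) = expR 4^-1 ^+ 12.
  by rewrite -expRM_natl; congr expR; lra.
apply: (@le_trans _ _ ((4 / 3) ^+ 12)); last by lra.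
by rewrite lerXn2r ?nnegrE ?expR_ge0 //; lra.
Qed.

Lemma sqrD1_le_expR (R : realType) (S : R) : 48 <= S -> S ^+ 2 + 1 <= expR (S / 2).
Proof.
move=> S48; have S0 : 0 <= S / 8 by lra.
have h := expR_ge1Dx (S / 8).
have -> : expR (S / 2) = expR (S / 8) ^+ 4.
  by rewrite -expRM_natl; congr expR; lra.
apply: (@le_trans _ _ ((1 + S / 8) ^+ 4)); last first.
  by rewrite lerXn2r ?nnegrE ?expR_ge0 //; lra.
set t := S / 8; have -> : S = 8 * t by rewrite /t; field.
have t6 : 6 <= t by rewrite /t; lra.
have h3 : 6 * t ^+ 2 <= t ^+ 3 by rewrite (exprS t 2) ler_wpM2r ?sqr_ge0.
have h4 : 36 * t ^+ 2 <= t ^+ 4.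
  rewrite (exprD t 2 2) ler_wpM2r ?sqr_ge0 //; nra.
have -> : (1 + t) ^+ 4 = 1 + 4 * t + 6 * t ^+ 2 + 4 * t ^+ 3 + t ^+ 4 by ring.
by nra.
Qed.

(** * Deterministic analysis of one SLPMM step *)

Section euclidean_space.
Context {R : realType} {n : nat}.
Implicit Types u v w : 'rV[R]_n.

Lemma dotvDr u v w : dotv u (v + w) = dotv u v + dotv u w.
Proof. by rewrite /dotv -big_split /=; apply: eq_bigr => i _; rewrite mxE mulrDr. Qed.

Lemma dotvZr (a : R) u v : dotv u (a *: v) = a * dotv u v.
Proof. by rewrite /dotv mulr_sumr; apply: eq_bigr => i _; rewrite mxE; ring. Qed.

Lemma dotvC u v : dotv u v = dotv v u.
Proof. by rewrite /dotv; apply: eq_bigr => i _; rewrite mulrC. Qed.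

Lemma dotvBr u v w : dotv u (v - w) = dotv u v - dotv u w.
Proof. by rewrite dotvDr -scaleN1r dotvZr mulN1r. Qed.

Lemma enorm_ge0 u : 0 <= enorm u. Proof. exact: sqrtr_ge0. Qed.

Lemma enorm_sqr u : enorm u ^+ 2 = dotv u u.
Proof. by rewrite /enorm sqr_sqrtr // sumr_ge0 // => i _; rewrite -expr2 sqr_ge0. Qed.

Lemma dotv_le u v : dotv u v <= enorm u * enorm v.
Proof. exact: cauchy_schwarz_sum. Qed.

Lemma dotv_ge u v : - (enorm u * enorm v) <= dotv u v.
Proof.
have -> : enorm u = enorm (- u).
  by congr Num.sqrt; apply: eq_bigr => i _; rewrite !mxE mulrNN.
have -> : dotv u v = - dotv (- u) v.
  by rewrite /dotv -sumrN; apply: eq_bigr => i _; rewrite mxE; ring.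
by rewrite lerN2 dotv_le.
Qed.

Lemma enorm_sqrB u v w :
  enorm (v - w) ^+ 2 = enorm (v - u) ^+ 2 + 2 * dotv (v - u) (u - w) + enorm (u - w) ^+ 2.
Proof.
have -> : v - w = (v - u) + (u - w) by rewrite addrA subrK.
rewrite !enorm_sqr; move: (v - u) (u - w) => a b.
by rewrite dotvDr ![dotv (a + b) _]dotvC !dotvDr (dotvC b a); ring.
Qed.

Lemma convex_setP (C : set 'rV[R]_n) : convex_set C ->
  forall x y (t : R), C x -> C y -> 0 <= t <= 1 -> C (t *: x + (1 - t) *: y).
Proof.
move=> cC x y t Cx Cy /andP[t0 t1].
have t01 : Itv.spec (Itv.num_sem (R := R)) (Itv.Real `[0%Z, 1%Z]) t.
  by apply/and3P; split => //; rewrite ?num_real.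
have := cC x y (Itv.mk t01) (mem_set Cx) (mem_set Cy).
by rewrite inE.
Qed.

(* Without the strong convexity term [enorm (y - z) ^+ 2], the bound on the increments
   would contain twice the contribution [kg * kf] of [theta2]. *)
Lemma prox_three_point (C : set 'rV[R]_n) (h : 'rV[R]_n -> R) (a : R) c z :
  convex_set C -> convex_on C h -> 0 <= a -> C z ->
  (forall y, C y -> h z + a / 2 * enorm (z - c) ^+ 2 <= h y + a / 2 * enorm (y - c) ^+ 2) ->
  forall y, C y ->
  h z + a / 2 * enorm (z - c) ^+ 2 + a / 2 * enorm (y - z) ^+ 2 <=
  h y + a / 2 * enorm (y - c) ^+ 2.
Proof.
move=> cC ch a0 Cz hz y Cy; rewrite (enorm_sqrB z y c).
set D := dotv _ _; set N := enorm (y - z) ^+ 2; set M := enorm (z - c) ^+ 2.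
suff : h z <= h y + a * D by lra.
have N0 : 0 <= N by exact: sqr_ge0.
apply/ler_addgt0Pr => e e0.
(* Minimality of [z] is tested at [t *: y + (1 - t) *: z]. After division by [t] the error is
   [t * (a / 2 * N)], which this choice keeps below [e]; the summand 1 keeps the denominator
   positive when [N = 0]. *)
pose t := Num.min 1 (e / (a / 2 * N + 1)).
have den0 : 0 < a / 2 * N + 1 by nra.
have t0 : 0 < t by rewrite lt_min ltr01 divr_gt0.
have t1 : t <= 1 by rewrite ge_min lexx.
have te : t * (a / 2 * N) <= e.
  apply: (@le_trans _ _ (t * (a / 2 * N + 1))); first by nra.
  by rewrite -ler_pdivlMr // ge_min lexx orbT.
have t01 : 0 <= t <= 1 by rewrite ltW.
have := hz _ (convex_setP cC Cy Cz t01).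
have := ch _ _ _ Cy Cz t01.
rewrite (enorm_sqrB z (_ + _) c).
have -> : t *: y + (1 - t) *: z - z = t *: (y - z).
  by rewrite scalerBl scale1r scalerBr addrA addrAC addrK.
rewrite !enorm_sqr [dotv (_ *: _) (z - c)]dotvC !dotvZr [dotv (_ *: _) _]dotvC !dotvZr.
rewrite -!enorm_sqr -/N -/M (dotvC (z - c)) -/D => h1 h2.
have : t * h z <= t * (h y + a * D + t * (a / 2 * N)) by nra.
by rewrite ler_pM2l //; lra.
Qed.

End euclidean_space.

Section positive_part.
Context {R : realType}.
Implicit Types a b t : R.

Lemma posp_ge0 a : 0 <= posp a. Proof. by rewrite le_max lexx orbT. Qed.

Lemma posp_ge a : a <= posp a. Proof. by rewrite le_max lexx. Qed.

Lemma posp_le a b : a <= b -> posp a <= posp b.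
Proof. by move=> ab; rewrite ge_max posp_ge0 (le_trans ab (posp_ge b)). Qed.

Lemma posp_sqr_le a : posp a ^+ 2 <= a ^+ 2.
Proof. by rewrite /posp; case: (leP a 0) => // a0; rewrite expr0n /= sqr_ge0. Qed.

Lemma posp_sqr_convex a b t : 0 <= t <= 1 ->
  posp (t * a + (1 - t) * b) ^+ 2 <= t * posp a ^+ 2 + (1 - t) * posp b ^+ 2.
Proof.
move=> /andP[t0 t1]; have s0 : 0 <= 1 - t by lra.
apply: (@le_trans _ _ ((t * posp a + (1 - t) * posp b) ^+ 2)).
  rewrite ler_sqr ?nnegrE ?posp_ge0 ?addr_ge0 ?mulr_ge0 ?posp_ge0 //.
  rewrite ge_max addr_ge0 ?mulr_ge0 ?posp_ge0 // andbT.
  by apply: lerD; apply: ler_wpM2l => //; exact: posp_ge.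
have : 0 <= t * (1 - t) * (posp a - posp b) ^+ 2.
  by apply: mulr_ge0; [exact: mulr_ge0|exact: sqr_ge0].
by nra.
Qed.

(** The square of the positive part is convex with derivative [2 * posp a], so it lies above its
    tangents. *)
Lemma posp_sqr_tangent a b : posp a ^+ 2 + 2 * posp a * b <= posp (a + b) ^+ 2.
Proof.
rewrite /posp; case: (leP a 0) => a0.
  by rewrite expr0n mulr0 mul0r addr0 /=; exact: sqr_ge0.
by case: (leP (a + b) 0) => ab; nra.
Qed.

End positive_part.

(** * Drift and length of a single proximal step *)

Section slpmm_step.
Context {R : realType} {n p : nat}.
Variables (C : set 'rV[R]_n) (s a : R) (Fk : R) (v0k : 'rV[R]_n).
Variables (Gk : 'I_p -> R) (vk : 'I_p -> 'rV[R]_n) (xk xk1 : 'rV[R]_n).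
Variables (lam lam1 : 'I_p -> R) (kf kg nu : R).
Hypotheses (cC : convex_set C) (s0 : 0 < s) (a0 : 0 < a) (Cxk1 : C xk1).
Hypothesis xk1_min : forall y, C y ->
  SLag s Fk v0k Gk vk xk xk1 lam + a / 2 * enorm (xk1 - xk) ^+ 2 <=
  SLag s Fk v0k Gk vk xk y lam + a / 2 * enorm (y - xk) ^+ 2.
Hypothesis lam1E : forall i, lam1 i = posp (lam i + s * (Gk i + dotv (vk i) (xk1 - xk))).
Hypotheses (kg0 : 0 <= kg) (v0k_le : enorm v0k <= kf) (vk_le : forall i, enorm (vk i) <= kg).
Hypothesis Gk_le : Num.sqrt (\sum_i Gk i ^+ 2) <= nu.

Lemma SLag_convex : convex_on C (fun x => SLag s Fk v0k Gk vk xk x lam).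
Proof.
move=> x y t _ _ t01; rewrite /SLag.
have E (u : 'rV[R]_n) : dotv u (t *: x + (1 - t) *: y - xk) =
    t * dotv u (x - xk) + (1 - t) * dotv u (y - xk).
  by rewrite !dotvBr dotvDr !dotvZr; ring.
have h : \sum_i posp (lam i + s * (Gk i + dotv (vk i) (t *: x + (1 - t) *: y - xk))) ^+ 2
   <= t * \sum_i posp (lam i + s * (Gk i + dotv (vk i) (x - xk))) ^+ 2
    + (1 - t) * \sum_i posp (lam i + s * (Gk i + dotv (vk i) (y - xk))) ^+ 2.
  rewrite !mulr_sumr -big_split /=; apply: ler_sum => i _.
  apply: le_trans (posp_sqr_convex _ _ t01); rewrite E le_eqVlt; apply/orP; left.
  by apply/eqP; congr (posp _ ^+ 2); ring.
rewrite E; move: h; set A := \sum_i _; set B := \sum_i _; set D := \sum_i _.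
move=> h; set L := \sum_i _; have i0 : 0 <= (2 * s)^-1 by rewrite invr_ge0 mulr_ge0 // ltW.
by have := ler_wpM2r i0 h; lra.
Qed.

Lemma slpmm_three_point y : C y ->
  SLag s Fk v0k Gk vk xk xk1 lam + a / 2 * enorm (xk1 - xk) ^+ 2
    + a / 2 * enorm (y - xk1) ^+ 2 <=
  SLag s Fk v0k Gk vk xk y lam + a / 2 * enorm (y - xk) ^+ 2.
Proof.
by apply: (prox_three_point cC SLag_convex (ltW a0) Cxk1) => z; exact: xk1_min.
Qed.

(** The three-point inequality is tested at [xh]. The penalty at [xk1] is exactly the new multiplier
    norm. At [xh] the linearised constraints lie below [Gh], so the penalty is at most that of
    [lam i + s * Gh i] with the positive part dropped. The two objective terms differ by
    [dotv v0k (xh - xk1)], and the squared step length is discarded. *)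
Lemma slpmm_drift (xh : 'rV[R]_n) (Gh : 'I_p -> R) (Rd : R) : C xh ->
  (forall i, Gk i + dotv (vk i) (xh - xk) <= Gh i) ->
  Num.sqrt (\sum_i Gh i ^+ 2) <= nu -> enorm (xh - xk1) <= Rd ->
  \sum_i lam1 i ^+ 2 + a * s * enorm (xh - xk1) ^+ 2 <=
  \sum_i lam i ^+ 2 + a * s * enorm (xh - xk) ^+ 2
  + 2 * s * (kf * Rd + s * nu ^+ 2 / 2 + \sum_i lam i * Gh i).
Proof.
move=> Cxh Ghle Ghnu xhRd; have := slpmm_three_point Cxh; rewrite /SLag.
under [X in _ + (X - _) / _]eq_bigr => i _ do rewrite -lam1E.
have nu2 : \sum_i Gh i ^+ 2 <= nu ^+ 2.
  rewrite -[leLHS]sqr_sqrtr ?sum_sqr_ge0 // ler_sqr ?nnegrE ?sqrtr_ge0 //.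
  exact: le_trans Ghnu; exact: sqrtr_ge0.
have h : \sum_i posp (lam i + s * (Gk i + dotv (vk i) (xh - xk))) ^+ 2 <=
    \sum_i lam i ^+ 2 + 2 * s * (\sum_i lam i * Gh i) + s ^+ 2 * \sum_i Gh i ^+ 2.
  rewrite !mulr_sumr -!big_split /=; apply: ler_sum => i _.
  have -> : lam i ^+ 2 + 2 * s * (lam i * Gh i) + s ^+ 2 * Gh i ^+ 2 =
    (lam i + s * Gh i) ^+ 2 by ring.
  apply: le_trans (posp_sqr_le _).
  rewrite ler_sqr ?nnegrE ?posp_ge0 //; apply: posp_le.
  by rewrite lerD2l ler_pM2l.
have v0 : dotv v0k (xh - xk) - dotv v0k (xk1 - xk) <= kf * Rd.
  have -> : dotv v0k (xh - xk) - dotv v0k (xk1 - xk) = dotv v0k (xh - xk1).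
    by rewrite !dotvBr; ring.
  apply: le_trans (dotv_le _ _) _; apply: ler_pM => //; exact: enorm_ge0.
move: nu2 h v0; set A := \sum_i _; set B := \sum_i _; set L := \sum_i lam i ^+ 2.
set M := \sum_i lam i * _; set L1 := \sum_i lam1 i ^+ 2 => nu2 h v0 h3.
have d0 : 0 <= a / 2 * enorm (xk1 - xk) ^+ 2.
  by rewrite mulr_ge0 ?sqr_ge0 // divr_ge0 // ltW.
have E (z : R) : z = 2 * s * (z / (2 * s)) by field; rewrite lt0r_neq0.
have hB : B <= L + 2 * s * M + s ^+ 2 * nu ^+ 2.
  by apply: le_trans h _; rewrite lerD2l ler_wpM2l ?sqr_ge0.
have h4 : (L1 - L) / (2 * s) + a / 2 * enorm (xh - xk1) ^+ 2 <=
  kf * Rd + (B - L) / (2 * s) + a / 2 * enorm (xh - xk) ^+ 2 by lra.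
have h5 := ler_wpM2l (ltW (mulr_gt0 (ltr0n _ 2) s0)) h4.
rewrite !mulrDr -!E in h5.
have := s0 => s0'.
by nra.
Qed.

(** The three-point inequality is tested at [xk] itself, where both quadratic terms become
    [a / 2 * e ^+ 2] with [e] the step length. The tangent of the squared positive part makes the
    remaining decrease linear in [e], and one factor [e] cancels. *)
Lemma slpmm_increment : C xk ->
  a * enorm (xk1 - xk) <=
  kf + Num.sqrt p%:R * kg * (Num.sqrt (\sum_i lam i ^+ 2) + s * nu).
Proof.
move=> Cxk; have := slpmm_three_point Cxk; rewrite /SLag subrr.
have Z (u : 'rV[R]_n) : dotv u 0 = 0 by rewrite -(subrr u) dotvBr subrr.
have -> : enorm (0 : 'rV[R]_n) ^+ 2 = 0 by rewrite enorm_sqr Z.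
have -> : enorm (xk - xk1) = enorm (xk1 - xk).
  by congr Num.sqrt; apply: eq_bigr => i _; rewrite !mxE; ring.
rewrite Z !addr0 mulr0 addr0.
set e := enorm _; have e0 : 0 <= e by exact: enorm_ge0.
pose b i := posp (lam i + s * Gk i).
set Q := \sum_i lam i ^+ 2.
have -> : \sum_i posp (lam i + s * (Gk i + dotv (vk i) 0)) ^+ 2 = \sum_i b i ^+ 2.
  by apply: eq_bigr => i _; rewrite Z addr0.
have h1 : \sum_i b i ^+ 2 - 2 * s * (kg * e * \sum_i b i) <=
   \sum_i posp (lam i + s * (Gk i + dotv (vk i) (xk1 - xk))) ^+ 2.
  rewrite !mulr_sumr -sumrB; apply: ler_sum => i _.
  rewrite mulrDr addrA; apply: le_trans (posp_sqr_tangent _ _) => /=.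
  rewrite -/(b i) lerD2l -[leRHS]mulrA mulrCA.
  have bi : 0 <= b i by exact: posp_ge0.
  have h : - (kg * e) <= dotv (vk i) (xk1 - xk).
    apply: le_trans (dotv_ge _ _); rewrite lerN2 ler_wpM2r //.
  have := ler_wpM2l (mulr_ge0 (ltW s0) bi) h; nra.
have h2 : \sum_i b i <= Num.sqrt p%:R * (Num.sqrt Q + s * nu).
  have -> : \sum_i b i = \sum_(i < p) 1 * b i.
    by apply: eq_bigr => i _; rewrite mul1r.
  apply: le_trans (cauchy_schwarz_sum _ _) _.
  have -> : \sum_(i < p) (1 : R) ^+ 2 = p%:R.
    by rewrite (eq_bigr (fun=> 1)) ?sumr_const ?card_ord // => i _; rewrite expr1n.
  apply: ler_wpM2l; first exact: sqrtr_ge0.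
  apply: (@le_trans _ _ (Num.sqrt (\sum_i (lam i + s * Gk i) ^+ 2))).
    by rewrite ler_sqrt ?sum_sqr_ge0 //; apply: ler_sum => i _; exact: posp_sqr_le.
  apply: le_trans (minkowski_sum _ _) _; rewrite lerD2l.
  have -> : \sum_i (s * Gk i) ^+ 2 = s ^+ 2 * \sum_i Gk i ^+ 2.
    by rewrite mulr_sumr; apply: eq_bigr => i _; rewrite exprMn.
  by rewrite sqrtrM ?sqr_ge0 // sqrtr_sqr gtr0_norm // ler_pM2l.
have h3 : - (kf * e) <= dotv v0k (xk1 - xk).
  by apply: le_trans (dotv_ge _ _); rewrite lerN2 ler_wpM2r.
move: h1; set B := \sum_i b i ^+ 2; set A := \sum_i posp _ ^+ 2.
move: h2; set S1 := \sum_i b i; set T := _ * (_ + _) => h2 h1 h4.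
have T0 : 0 <= kg * T.
  by rewrite mulr_ge0 // (le_trans _ h2) // sumr_ge0 // => i _; exact: posp_ge0.
have -> : Num.sqrt p%:R * kg * (Num.sqrt Q + s * nu) = kg * T by rewrite /T; ring.
have kf0 : 0 <= kf := le_trans (enorm_ge0 _) v0k_le.
have [->|ne0] := eqVneq e 0; first by rewrite mulr0 addr_ge0.
have ep : 0 < e by rewrite lt0r ne0.
have E (z : R) : (2 * s * z) / (2 * s) = z by field; rewrite lt0r_neq0.
have h5 : B / (2 * s) - kg * e * S1 <= A / (2 * s).
  have i0 : 0 <= (2 * s)^-1 by rewrite invr_ge0 mulr_ge0 // ltW.
  by have := ler_wpM2r i0 h1; rewrite mulrBl E.
have h6 : kg * e * S1 <= kg * e * T by rewrite ler_wpM2l // mulr_ge0.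
have : a * e * e <= (kf + kg * T) * e by rewrite -subr_ge0; move: h4; rewrite !mulrBl; lra.
by rewrite ler_pM2r.
Qed.

End slpmm_step.

(** * Joint measurability and independence of the past *)

(** Sequential and coordinatewise, the form in which continuity enters the limit arguments on
    measurability and dominated convergence. *)
Definition seq_continuous_on {R : realType} {n : nat} (S : set 'rV[R]_n)
    (h : 'rV[R]_n -> R) :=
  forall (y : nat -> 'rV[R]_n) (u : 'rV[R]_n), (forall m, S (y m)) -> S u ->
    (forall j, (fun m => y m 0 j) @ \oo --> u 0 j) -> (fun m => h (y m)) @ \oo --> h u.

Lemma within_seq_continuous (R : realType) n (S : set 'rV[R]_n) (h : 'rV[R]_n -> R) :
  {within S, continuous h} -> seq_continuous_on S h.
Proof.
move=> ch y u Sy Su yu.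
have yu' : y @ \oo --> u.
  apply/cvg_ballP => e e0.
  have near_j (j : 'I_n) : \forall m \near \oo, ball (u 0 j) e (y m 0 j).
    exact: (cvg_ball (yu j)).
  have hm : \forall m \near \oo, ball u e (y m).
    apply: filterS (filter_forall _ near_j) => m hm.
    by split=> // i j; rewrite ord1; exact: hm.
  exact: hm.
have yS : y @ \oo --> (u : subspace S).
  apply/subspace_cvgP => // A hA.
  have h1 : \forall m \near \oo, S (y m) -> A (y m) by exact: yu' hA.
  have hm : \forall m \near \oo, A (y m) by apply: filterS h1 => m; exact.
  exact: hm.
exact: cvg_comp yS (ch u).
Qed.

(** Joint measurability of a Carathéodory function along [U]: [U] is replaced by approximations with
    countably many values, for which the composition is measurable piece by piece, and continuity in
    the first variable passes to the limit. *)
Lemma measurable_comp_caratheodory (R : realType) d (T : measurableType d) n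
    (S : set 'rV[R]_n) (U : T -> 'rV[R]_n) (H : 'rV[R]_n -> T -> R) :
  (forall t, S (U t)) -> (forall j, measurable_fun setT (fun t => U t 0 j)) ->
  (forall u, S u -> measurable_fun setT (H u)) ->
  (forall t, seq_continuous_on S (H ^~ t)) ->
  measurable_fun setT (fun t => H (U t) t).
Proof.
move=> SU mU mH cH.
(* [code m u] indexes the cell of mesh [1 / (m + 1)] containing [u], and [rep] selects a point of
   [S] in that cell, since grid points may lie outside [S]. The default [U point] is in [S] too. *)
pose code m (u : 'rV[R]_n) : 'rV[int]_n := \row_j Num.floor (m.+1%:R * u 0 j).
pose rep m (c : 'rV[int]_n) := xget (U point) [set u | S u /\ code m u = c].
have repS m c : S (rep m c).
  by rewrite /rep; case: xgetP => [u _ []|_] //; exact: SU.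
have repK m t : code m (rep m (code m (U t))) = code m (U t).
  by rewrite /rep; case: xgetP => [u _ []//|/(_ (U t))]; case.
apply: (@measurable_fun_cvg _ _ _ _ (fun m t => H (rep m (code m (U t))) t)).
  move=> m _ Y mY; rewrite setTI.
  have -> : (fun t => H (rep m (code m (U t))) t) @^-1` Y =
    \bigcup_c ([set t | code m (U t) = c] `&` H (rep m c) @^-1` Y).
    apply/seteqP; split => t /=; first by exists (code m (U t)).
    by move=> [c _ [/= <-]].
  apply: countable_bigcupT_measurable => // c; apply: measurableI; last first.
    by rewrite -[X in measurable X]setTI; exact: mH.
  have -> : [set t | code m (U t) = c] = \bigcap_(j : 'I_n)
     ((fun t => m.+1%:R * U t 0 j) @^-1` `[(c 0 j)%:~R, (c 0 j + 1)%:~R[%classic).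
    apply/seteqP; split => t /=.
      by move=> <- j _ /=; rewrite in_itv /= !mxE floor_itv.
    move=> h; apply/rowP => j; rewrite mxE; apply: floor_def.
    by have := h j I; rewrite /= in_itv.
  apply: fin_bigcap_measurable => // j _.
  rewrite -[X in measurable X]setTI; apply: measurable_funM => //.
move=> t _; apply: cH => // j.
apply/cvgrPdist_lt => e e0.
have : \forall m \near \oo, (m.+1%:R : R)^-1 < e by exact: (near_infty_natSinv_lt (PosNum e0)).
apply: filterS => m; apply: le_lt_trans.
have /rowP/(_ j) := repK m t; rewrite !mxE; set a := U t 0 j; set b := rep _ _ 0 j => E.
have := floor_itv (m.+1%:R * a); have := floor_itv (m.+1%:R * b); rewrite E !intrD.
set k := (Num.floor _)%:~R : R => /andP[h1 h2] /andP[h3 h4].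
have m0 : 0 < m.+1%:R :> R by [].
rewrite -[leRHS]mul1r ler_pdivlMr // -[X in _ * X](gtr0_norm m0) -normrM ler_norml.
by rewrite mulrBl [a * _]mulrC [b * _]mulrC; apply/andP; split; lra.
Qed.

(** * The sigma-algebra of the past and its independence of the next sample *)

Section independence.
Context {R : realType} d (T : measurableType d) (P : probability T R).
Local Open Scope ereal_scope.

(** By independence the law of the pair agrees with the product measure on rectangles, hence
    everywhere; Tonelli's theorem then gives the iterated integral. *)
Lemma integral_independent_pair d1 d2 (T1 : measurableType d1) (T2 : measurableType d2)
    (X : T -> T1) (Y : T -> T2) (mY : measurable_fun setT Y)
    (Q : probability T2 R) (h : T1 -> T2 -> \bar R) :
  measurable_fun setT X ->
  (forall B, measurable B -> P (Y @^-1` B) = Q B) ->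
  (forall A B, measurable A -> measurable B ->
     P (X @^-1` A `&` Y @^-1` B) = P (X @^-1` A) * P (Y @^-1` B)) ->
  measurable_fun setT (fun z : T1 * T2 => h z.1 z.2) -> (forall x y, 0 <= h x y) ->
  \int[P]_w h (X w) (Y w) = \int[P]_w \int[Q]_y h (X w) y.
Proof.
move=> mX YQ indep mh h0.
pose Xm : {RV P >-> T1} := HB.pack X (isMeasurableFun.Build _ _ _ _ X mX).
pose W w := (X w, Y w).
have mW : measurable_fun setT W by exact: measurable_fun_pair.
pose Wm : {RV P >-> (T1 * T2)%type} := HB.pack W (isMeasurableFun.Build _ _ _ _ W mW).
have E A : measurable A -> (distribution P Xm \x Q) A = distribution P Wm A.
  apply: product_measure_unique => A1 A2 mA1 mA2.
  by have := indep _ _ mA1 mA2; rewrite YQ.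
transitivity (\int[P]_w ((fun z => h z.1 z.2) \o Wm) w) => //.
rewrite -ge0_integral_distribution //.
rewrite (eq_measure_integral (distribution P Xm \x Q)); last first.
  by move=> A mA _; apply/esym; exact: E.
rewrite fubini_tonelli1 // /fubini_F ge0_integral_distribution //.
- have := @measurable_fun_fubini_tonelli_F _ _ T1 T2 R Q _ mh.
  by rewrite /fubini_F; apply => x.
- by move=> x; apply: integral_ge0 => y _.
Qed.

Context d' (X : measurableType d') (xs : nat -> T -> X).
Hypothesis mxs : forall k, measurable_fun setT (xs k).
Hypothesis indep : mutually_independent P xs.

(** The sample space with the sigma-algebra of [xs 0], ..., [xs (k - 1)]. Adaptedness becomes
    measurability on this type, and conditioning on the past becomes integration over the second
    factor of [past k * X]. *)
Definition past k : Type := g_sigma_algebraType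
  (\big[setU/set0]_(m < k) preimage_set_system setT (xs m) measurable).

HB.instance Definition _ k := Measurable.on (past k).

Lemma past_xs k m (A : set X) : (m < k)%N -> measurable A ->
  natural_sigma xs k (xs m @^-1` A).
Proof.
move=> mk mA; apply: sub_sigma_algebra; rewrite (bigD1 (Ordinal mk)) //=; left.
by exists A => //; rewrite setTI.
Qed.

Lemma past_sub k (M : set (set T)) : sigma_algebra setT M ->
  (forall m (A : set X), (m < k)%N -> measurable A -> M (xs m @^-1` A)) ->
  natural_sigma xs k `<=` M.
Proof.
move=> sM xsM; apply: smallest_sub => //.
apply: (big_ind (fun F => F `<=` M)) => //; first by move=> A B AM BM; rewrite subUset.
by move=> i _ _ [A mA <-]; rewrite setTI; exact: xsM.
Qed.

Lemma past_mono k A : natural_sigma xs k A -> natural_sigma xs k.+1 A.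
Proof.
move: A; apply: past_sub; first exact: smallest_sigma_algebra.
by move=> m A mk mA; apply: past_xs => //; exact: ltnW.
Qed.

Lemma past_measurable k A : natural_sigma xs k A -> measurable A.
Proof.
move: A; apply: past_sub; first exact: sigma_algebra_measurable.
by move=> m A mk mA; rewrite -[X in measurable X]setTI; exact: mxs.
Qed.

(** A pi-system argument: for fixed [B], both sides are finite measures in [A]. They agree on the
    cylinder sets, which are stable under intersection and generate the past. *)
Lemma past_independent k (A : set T) (B : set X) :
  natural_sigma xs k A -> measurable B ->
  P (A `&` xs k @^-1` B) = P A * P (xs k @^-1` B).
Proof.
move=> kA mB.
pose G := [set A | exists2 E : nat -> set X, forall m, measurable (E m) &
   A = \bigcap_(m in [set m | m \in iota 0 k]) (xs m @^-1` E m)].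
have mxsE m (E : set X) : measurable E -> measurable (xs m @^-1` E).
  by move=> mE; rewrite -[X in measurable X]setTI; exact: mxs.
have mG : G `<=` measurable.
  move=> _ [E mE ->]; apply: bigcap_measurableType => m _; exact: mxsE.
have GI : setI_closed G.
  move=> _ _ [E mE ->] [E' mE' ->]; exists (fun m => E m `&` E' m).
    by move=> m; exact: measurableI.
  by rewrite -bigcapI.
have GT : G setT by exists (fun=> setT) => //; rewrite bigcapT.
have kG : natural_sigma xs k `<=` <<s G >>.
  apply: past_sub; first exact: smallest_sigma_algebra.
  move=> m E mk mE; apply: sub_sigma_algebra.
  exists (fun j => if j == m then E else setT); first by move=> j; case: ifP.
  apply/seteqP; split => w /=.
    by move=> wE j _; case: eqP => // ->.
  by move=> /(_ m); rewrite eqxx /= mem_iota; exact.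
have mD := mxsE k B mB.
pose r : {nonneg R} := NngNum (fine_ge0 (measure_ge0 P (xs k @^-1` B))).
have rE : (r%:num)%:E = P (xs k @^-1` B) by rewrite /= fineK // fin_num_measure.
have gT : \bigcup_(i : nat) (setT : set T) = setT.
  by apply/seteqP; split => // w _; exists 0%N.
suff : mrestr P mD A = mscale r P A by rewrite /mrestr /mscale rE muleC.
apply: (@g_sigma_algebra_measure_unique _ R _ G mG (fun=> setT) (fun=> GT) gT
  (mrestr P mD) (mscale r P) GI _ _ A (kG _ kA)).
- move=> A' [E mE A'E].
  transitivity (P A' * P (xs k @^-1` B)); last by rewrite -rE muleC.
  change (P (A' `&` xs k @^-1` B) = P A' * P (xs k @^-1` B)); rewrite {}A'E.
  have kk : k \notin iota 0 k by rewrite mem_iota add0n ltnn andbF.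
  (* The cylinder is extended by the event [B] at the fresh index [k], so that mutual independence
     applies to the list [rcons (iota 0 k) k]. *)
  pose E' j := if j == k then B else E j.
  have mE' j : measurable (E' j) by rewrite /E'; case: ifP.
  have E'E j : j \in iota 0 k -> E' j = E j.
    by rewrite /E'; case: eqP => // -> h; rewrite h in kk.
  have h1 := indep (iota_uniq 0 k) mE.
  have := @indep (rcons (iota 0 k) k) E'; rewrite rcons_uniq kk iota_uniq => /(_ isT mE').
  have E'k : E' k = B by rewrite /E' eqxx.
  rewrite -[in X in _ = X]cats1 big_cat big_seq1 E'k /=.
  rewrite (eq_big_seq (fun j => P (xs j @^-1` E j))) => [|j jk]; last by rewrite E'E.
  rewrite -h1 => <-; congr (P _).
  apply/seteqP; split => w /=.
    move=> [wE wB] j /=; rewrite mem_rcons inE => /orP[/eqP ->|jk]; first by rewrite E'k.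
    by rewrite E'E //; exact: wE.
  move=> h; split.
    by move=> j /= jk; rewrite -E'E //; apply: h; rewrite /= mem_rcons inE jk orbT.
  by rewrite -E'k; apply: (h k); rewrite /= mem_rcons inE eqxx.
- move=> _; apply: (@le_lt_trans _ _ 1); last exact: ltry.
  by apply: probability_le1; exact: measurableI.
Qed.

End independence.

(** * Exponential moments *)

Section past_step.
Context {R : realType} d (T : measurableType d) (P : probability T R).
Context d' (X : measurableType d') (xs : nat -> T -> X).
Hypothesis mxs : forall k, measurable_fun setT (xs k).
Hypothesis indep : mutually_independent P xs.

Lemma past_measurable_fun k d1 (T1 : measurableType d1) (f : T -> T1) :
  measurable_fun (setT : set (past xs k)) f -> measurable_fun (setT : set T) f.
Proof.
move=> mf _ B mB; rewrite setTI; apply: (past_measurable mxs (k := k)).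
by have := mf measurableT _ mB; rewrite setTI.
Qed.

(** The supermartingale step, with conditional expectation expressed by Tonelli's theorem: with the
    past frozen, [xs k] has law [Q], so the factor [h] averages to at most 1. *)
Lemma integral_past_step k (Q : probability X R) (Y : T -> R) (h : T -> X -> R) :
  (forall B, measurable B -> P (xs k @^-1` B) = Q B) ->
  measurable_fun (setT : set (past xs k)) Y -> (forall w, 0 <= Y w) ->
  measurable_fun (setT : set (past xs k * X)) (fun z => h z.1 z.2) ->
  (forall w z, 0 <= h w z) -> (forall w, (\int[Q]_z (h w z)%:E <= 1)%E) ->
  (\int[P]_w (Y w * h w (xs k w))%:E <= \int[P]_w (Y w)%:E)%E.
Proof.
move=> PQ mY Y0 mh h0 h1.
pose h' (w : past xs k) z := (Y w * h w z)%:E.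
have mh' : measurable_fun setT (fun z : past xs k * X => h' z.1 z.2).
  apply/measurable_EFinP; apply: measurable_funM => //.
  by apply: (measurableT_comp mY); exact: measurable_fst.
have h'0 w z : (0 <= h' w z)%E by rewrite lee_fin mulr_ge0.
have mid : measurable_fun (setT : set T) (id : T -> past xs k).
  by move=> _ B mB; rewrite setTI; exact: (past_measurable mxs mB).
have ind A B : measurable (A : set (past xs k)) -> measurable B ->
    P (id @^-1` A `&` xs k @^-1` B) = (P (id @^-1` A) * P (xs k @^-1` B))%E.
  by move=> mA mB; exact: past_independent.
rewrite (@integral_independent_pair _ _ _ P _ _ (past xs k) X (id : T -> past xs k)
  (xs k) (mxs k) Q h' mid PQ ind mh' h'0).
apply: ge0_le_integral => //.
- by move=> w _; apply: integral_ge0 => z _; exact: h'0.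
- apply: (@past_measurable_fun k); apply: (measurable_fun_fubini_tonelli_F _ mh').
  by move=> x; exact: h'0.
- by apply/measurable_EFinP; exact: past_measurable_fun mY.
- move=> w _; rewrite /h'; under eq_integral do rewrite EFinM.
  rewrite ge0_integralZl //.
  + by rewrite -[leRHS]mule1 lee_wpmul2l // lee_fin.
  + apply/measurable_EFinP.
    have mw : measurable_fun setT (fun z : X => ((w : past xs k), z)).
      by apply: measurable_fun_pair.
    exact: (measurableT_comp mh mw).
  + by move=> z _; rewrite lee_fin.
  + by rewrite lee_fin.
Qed.

End past_step.

(** * Moment generating functions of centred and weighted constraints *)

Section subgaussian.
Context {R : realType} d (X : measurableType d) (Q : probability X R).

Lemma bounded_integrable (f : X -> R) (M : R) : measurable_fun setT f ->
  (forall x, `|f x| <= M) -> Q.-integrable setT (EFin \o f).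
Proof.
move=> mf fM.
apply: (le_integrable measurableT _ _ (finite_measure_integrable_cst Q M measurableT)).
- exact/measurable_EFinP.
- by move=> x _ /=; rewrite lee_fin (le_trans (fM x)) // ler_norm.
Qed.

Lemma integral_le_affine (f D Z : X -> R) (a b c M : R) :
  measurable_fun setT f -> (forall x, 0 <= f x) ->
  Q.-integrable setT (EFin \o D) -> (\int[Q]_x (D x)%:E = 0)%E ->
  measurable_fun setT Z -> (forall x, 0 <= Z x) -> (\int[Q]_x (Z x)%:E <= M%:E)%E ->
  0 <= c -> (forall x, f x <= a + b * D x + c * Z x) ->
  (\int[Q]_x (f x)%:E <= (a + c * M)%:E)%E.
Proof.
move=> mf f0 iD D0 mZ Z0 ZM c0 fle.
have iZ : Q.-integrable setT (EFin \o Z).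
  apply/integrableP; split; first exact/measurable_EFinP.
  under eq_integral => x _ do rewrite /= ger0_norm //.
  exact: le_lt_trans ZM (ltry _).
have ia : Q.-integrable setT (EFin \o cst a) by exact: finite_measure_integrable_cst.
have ibD : Q.-integrable setT (fun x => b%:E * (D x)%:E)%E by exact: integrableZl.
have icZ : Q.-integrable setT (fun x => c%:E * (Z x)%:E)%E by exact: integrableZl.
apply: (@le_trans _ _ (\int[Q]_x (a%:E + b%:E * (D x)%:E + c%:E * (Z x)%:E))%E).
  apply: ge0_le_integral => //.
  - by move=> x _; rewrite lee_fin.
  - exact/measurable_EFinP.
  - apply: emeasurable_funD; last exact: measurable_int icZ.
    by apply: emeasurable_funD => //; exact: measurable_int ibD.
  - by move=> x _; rewrite -!EFinM -!EFinD lee_fin.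
rewrite integralD //; last by apply: integrableD.
rewrite integralD // integralZl // integralZl // D0 mule0 adde0.
rewrite integral_cst // [X in (_ * X)%E]probability_setT mule1 EFinD EFinM.
by rewrite leeD2l // lee_wpmul2l // lee_fin.
Qed.

(** For a small exponent the first-order term must cancel by centring; for a large one Young's
    inequality suffices. In both cases [expR_conv1] turns the bound on the exponential square moment
    into one for a smaller exponent. *)
Lemma subgaussian_mgf (D : X -> R) (t s : R) : 0 < t ->
  measurable_fun setT D -> Q.-integrable setT (EFin \o D) -> (\int[Q]_x (D x)%:E = 0)%E ->
  (\int[Q]_x (expR (D x ^+ 2 / t ^+ 2))%:E <= (expR 1)%:E)%E ->
  (\int[Q]_x (expR (s * D x))%:E <= (expR (2 * s ^+ 2 * t ^+ 2))%:E)%E.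
Proof.
move=> t0 mD iD D0 hD.
have t2 : 0 < t ^+ 2 by rewrite exprn_gt0.
have mZ : measurable_fun setT (fun x => expR (D x ^+ 2 / t ^+ 2)).
  by apply: measurableT_comp => //; apply: measurable_funM => //; exact: measurable_funX.
have mf : measurable_fun setT (fun x => expR (s * D x)).
  by apply: measurableT_comp => //; exact: measurable_funM.
set v := 2 * s ^+ 2 * t ^+ 2.
have v0 : 0 <= v by rewrite /v -mulrA -exprMn mulr_ge0 // sqr_ge0.
have e1 : expR (-1) * expR 1 = 1 :> R by rewrite -expRD addNr expR0.
have [v1|v1] := leP v 1.
  have -> : expR v = expR v * (1 - v) + expR v * v * expR (-1) * expR 1.
    by rewrite -[expR v * v * _ * _]mulrA e1; ring.
  apply: (integral_le_affine (D := D) (b := s) (Z := fun x => expR (D x ^+ 2 / t ^+ 2))) => //.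
  - by rewrite mulr_ge0 ?expR_ge0 // mulr_ge0 ?expR_ge0.
  - move=> x; apply: le_trans (expR_leD_expR_sqr _) _.
    have -> : 2 * (s * D x) ^+ 2 = v * (D x ^+ 2 / t ^+ 2) by rewrite /v; field; rewrite lt0r_neq0.
    have := expR_conv1 (D x ^+ 2 / t ^+ 2) (s := v).
    rewrite v0 v1 => /(_ isT); rewrite [X in expR (X - 1)]/= expRD; lra.
(* Here [v > 1]. Young's inequality [s D <= s^2 t^2 / 2 + D^2 / (2 t^2)] yields the bound [c], the
   exponential of [v / 4 + 1 / 2], which is below that of [v]. *)
pose c := expR (s ^+ 2 * t ^+ 2 / 2) * expR 2^-1.
apply: (@le_trans _ _ (c * 2^-1 + c * 2^-1 * expR (-1) * expR 1)%:E).
  apply: (integral_le_affine (D := D) (b := 0) (Z := fun x => expR (D x ^+ 2 / t ^+ 2))) => //.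
  - by rewrite mulr_ge0 ?expR_ge0 // mulr_ge0 // mulr_ge0 ?expR_ge0.
  - move=> x; rewrite mul0r addr0.
    apply: (@le_trans _ _ (expR (s ^+ 2 * t ^+ 2 / 2) * expR (2^-1 * (D x ^+ 2 / t ^+ 2)))).
      rewrite -expRD ler_expR.
      have -> : s * D x = (s * t) * (D x / t) by field; rewrite lt0r_neq0.
      have -> : D x ^+ 2 / t ^+ 2 = (D x / t) ^+ 2 by rewrite expr_div_n.
      have := sqr_ge0 (s * t - D x / t); rewrite sqrrB exprMn; lra.
    have := expR_conv1 (D x ^+ 2 / t ^+ 2) (s := 2^-1).
    have h : 0 <= (2^-1 : R) <= 1 by rewrite invr_ge0 ler0n invf_le1 // ler1n.
    move=> /(_ h); rewrite [expR (_ - 1)]expRD.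
    by move/(ler_wpM2l (expR_ge0 (s ^+ 2 * t ^+ 2 / 2))); rewrite /c; lra.
have -> : c * 2^-1 + c * 2^-1 * expR (-1) * expR 1 = c.
  by rewrite -[c * 2^-1 * _ * _]mulrA e1; lra.
by rewrite lee_fin /c -expRD ler_expR; rewrite /v in v1 *; lra.
Qed.

Lemma integral_bounded_le (f : X -> R) (M : R) : measurable_fun setT f ->
  (forall x, `|f x| <= M) -> `|fine (\int[Q]_x (f x)%:E)| <= M.
Proof.
move=> mf fM; apply: le_trans (le_normr_Rintegral measurableT (bounded_integrable mf fM)) _.
have M0 : 0 <= M by apply: le_trans (fM point).
rewrite -lee_fin /Rintegral fineK.
  apply: (@le_trans _ _ (\int[Q]_x (cst M%:E) x)%E).
    apply: ge0_le_integral => //.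
    - by apply/measurable_EFinP; exact: measurableT_comp.
    - by move=> x _; rewrite lee_fin.
  by rewrite integral_cst // [X in (_ * X)%E]probability_setT mule1.
apply: integrable_fin_num => //; apply: (@bounded_integrable _ M).
  exact: measurableT_comp.
by move=> x; rewrite normr_id.
Qed.

Lemma bounded_centered (f : X -> R) (M : R) : measurable_fun setT f ->
  (forall x, `|f x| <= M) ->
  let D x := f x - fine (\int[Q]_x (f x)%:E) in
  [/\ measurable_fun setT D, Q.-integrable setT (EFin \o D),
      (\int[Q]_x (D x)%:E = 0)%E & forall x, `|D x| <= 2 * M].
Proof.
move=> mf fM /=; set m := fine _.
have iF := bounded_integrable mf fM.
have mD : measurable_fun setT (fun x => f x - m) by exact: measurable_funB.
have DM x : `|f x - m| <= 2 * M.
  apply: le_trans (ler_normB _ _) _; have := fM x.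
  have := integral_bounded_le mf fM; rewrite -/m; lra.
split=> //; first exact: bounded_integrable DM.
under eq_integral do rewrite EFinB.
rewrite integralB //; last exact: finite_measure_integrable_cst.
rewrite integral_cst // [X in (_ * X)%E]probability_setT mule1 /m fineK ?subee //; exact: integrable_fin_num.
Qed.

Lemma integral_expR_sqr_bounded (D : X -> R) (t : R) : 0 < t ->
  measurable_fun setT D -> (forall z, `|D z| <= t) ->
  (\int[Q]_z (expR (D z ^+ 2 / t ^+ 2))%:E <= (expR 1)%:E)%E.
Proof.
move=> t0 mD Dt; apply: (@le_trans _ _ (\int[Q]_x (cst (expR 1)%:E) x)%E).
  apply: ge0_le_integral => //.
    apply/measurable_EFinP; apply: measurableT_comp => //.
    by apply: measurable_funM => //; exact: measurable_funX.
  move=> z _; rewrite lee_fin ler_expR ler_pdivrMr ?exprn_gt0 // mul1r.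
  by rewrite -[leLHS]real_normK ?num_real // ler_sqr ?nnegrE ?Dt ?(ltW t0).
by rewrite integral_cst // [X in (_ * X)%E]probability_setT mule1.
Qed.

(* Depending on the l1-norm of the weights [y], either the boundedness or the
   subgaussian tail of the noise gives the smaller variance proxy; both cases
   need no more than [s <= e / (8 a t)]. *)
Lemma drift_mgf (p : nat) (y : 'I_p -> R) (G : 'I_p -> X -> R) (a e t s : R) :
  0 < a -> 0 < e -> 0 < t -> 0 <= s -> s * (8 * a * t) <= e ->
  (forall i, 0 <= y i) -> \sum_i y i ^+ 2 <= 1 ->
  (forall i, measurable_fun setT (G i)) ->
  (forall z, Num.sqrt (\sum_i G i z ^+ 2) <= a) ->
  (forall i, fine (\int[Q]_z (G i z)%:E) <= - e) ->
  (forall i, (\int[Q]_z (expR ((G i z - fine (\int[Q]_z (G i z)%:E)) ^+ 2 / t ^+ 2))%:E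
      <= (expR 1)%:E)%E) ->
  (\int[Q]_z (expR (s * \sum_i y i * (G i z + e / 2)))%:E <= 1)%E.
Proof.
move=> a0 e0 t0 s0 sle y0 y1 mG Ga ge hG.
have Gia i z : `|G i z| <= a.
  apply: le_trans (Ga z); rewrite -sqrtr_sqr ler_sqrt ?sum_sqr_ge0 //.
  by rewrite (bigD1 i) //= lerDl sumr_ge0 // => j _; exact: sqr_ge0.
have DG i := bounded_centered (mG i) (Gia i).
set g := fun i => fine (\int[Q]_z (G i z)%:E) in ge hG DG.
set r := \sum_i y i.
pose Y z := \sum_i y i * G i z.
have mY : measurable_fun setT Y.
  by apply: measurable_sum => i; exact: measurable_funM.
have Y_le z : `|Y z| <= a.
  have y1' : Num.sqrt (\sum_i y i ^+ 2) <= 1 by rewrite -sqrtr1 ler_sqrt.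
  have le_a (u : 'I_p -> R) : \sum_i u i ^+ 2 = \sum_i y i ^+ 2 -> \sum_i u i * G i z <= a.
    move=> uy; apply: le_trans (cauchy_schwarz_sum _ _) _; rewrite uy -[leRHS]mul1r.
    by apply: ler_pM => //; exact: sqrtr_ge0.
  rewrite ler_norml le_a // andbT lerNl -sumrN.
  under eq_bigr do rewrite -mulNr.
  by apply: le_a; apply: eq_bigr => i _; rewrite sqrrN.
have EY : fine (\int[Q]_z (Y z)%:E) = \sum_i y i * g i.
  under eq_integral => z _ do rewrite /Y -sumEFin.
  rewrite integral_sum //; last first.
    move=> i; under eq_fun do rewrite EFinM.
    by apply: integrableZl => //; exact: bounded_integrable (Gia i).
  rewrite (eq_bigr (fun i => (y i * g i)%:E)) ?sumEFin // => i _.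
  under eq_integral do rewrite EFinM.
  rewrite integralZl //; last exact: bounded_integrable (Gia i).
  rewrite EFinM /g fineK //; apply: integrable_fin_num => //.
  exact: bounded_integrable (Gia i).
have [mD iD D0 D_le] := bounded_centered mY Y_le.
set D := fun x => Y x - _ in mD iD D0 D_le.
have DE z : D z = \sum_i y i * (G i z - g i).
  by rewrite /D EY /Y -sumrB; apply: eq_bigr => i _; rewrite mulrBr.
have r0 : 0 <= r by exact: sumr_ge0.
have mE (u : X -> R) : measurable_fun setT u -> measurable_fun setT (fun z => expR (s * u z)).
  by move=> mu; apply: measurableT_comp => //; exact: measurable_funM.
(* The weighted sum has mean at most [- r * e]; the shift by [e / 2] leaves the drift
   [- r * (e / 2)], which has to pay for the exponent [M] of the centred part. *)
have step M : (\int[Q]_z (expR (s * D z))%:E <= (expR M)%:E)%E -> M <= s * (r * (e / 2)) ->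
    (\int[Q]_z (expR (s * \sum_i y i * (G i z + e / 2)))%:E <= 1)%E.
  move=> hM Ms; set q := expR (- (s * (r * (e / 2)))).
  apply: (@le_trans _ _ (\int[Q]_z (q%:E * (expR (s * D z))%:E))%E).
    apply: ge0_le_integral => //.
    - by apply/measurable_EFinP; apply: mE; apply: measurable_sum => i;
        apply: measurable_funM => //; exact: measurable_funD.
    - by apply/measurable_EFinP; apply: measurable_funM => //; exact: mE.
    move=> z _; rewrite -EFinM lee_fin -expRD ler_expR.
    have : \sum_i y i * (G i z + e / 2) <= D z - r * (e / 2).
      rewrite DE /r mulr_suml -sumrB; apply: ler_sum => i _.
      rewrite -mulrBr ler_wpM2l //; have gi : g i <= - e by exact: ge.
      lra.
    by move/(ler_wpM2l s0); lra.
  have mDE : measurable_fun setT (fun z => (expR (s * D z))%:E).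
    by apply/measurable_EFinP; exact: mE.
  have q0 : (0 <= q%:E)%E by rewrite lee_fin expR_ge0.
  rewrite ge0_integralZl //.
  apply: (@le_trans _ _ (q%:E * (expR M)%:E)%E); first by rewrite lee_wpmul2l.
  by rewrite -EFinM -expRD lee_fin expR_le1 addrC subr_le0.
have [rt|rt] := leP (r * t) (2 * a); last first.
  have a2 : 0 < 2 * a by rewrite mulr_gt0.
  apply: (step (2 * s ^+ 2 * (2 * a) ^+ 2)).
    apply: subgaussian_mgf => //.
    exact: integral_expR_sqr_bounded.
  have -> : 2 * s ^+ 2 * (2 * a) ^+ 2 = s * (8 * a * a * s) by ring.
  rewrite ler_wpM2l //.
  have h1 : s * (8 * a * t) * (r * 2^-1) <= e * (r * 2^-1) by rewrite ler_wpM2r // mulr_ge0.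
  have h2 : (s * (4 * a)) * (2 * a) <= (s * (4 * a)) * (r * t).
    by apply: ler_wpM2l; [rewrite !mulr_ge0 // ltW|exact: ltW].
  by lra.
(* The weights are about to be normalised by [r]; if [r = 0] they all vanish and so does [D]. *)
have [r00|rn0] := eqVneq r 0.
  have y00 i : y i = 0.
    apply/eqP; rewrite eq_le y0 andbT -r00 /r (bigD1 i) //= lerDl.
    exact: sumr_ge0.
  have h0 : 0 <= s * (r * (e / 2)) by rewrite r00 mul0r mulr0.
  apply: step h0.
  have D00 z : D z = 0 by rewrite DE big1 // => i _; rewrite y00 mul0r.
  under eq_integral => z _ do rewrite D00 mulr0.
  by rewrite integral_cst // [X in (_ * X)%E]probability_setT mule1.
have rp : 0 < r by rewrite lt0r rn0.
apply: (step (2 * (s * r) ^+ 2 * t ^+ 2)); last first.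
  have -> : 2 * (s * r) ^+ 2 * t ^+ 2 = s * (r * (2 * s * t * (r * t))) by ring.
  rewrite !ler_wpM2l //.
  have h2 : (2 * s * t) * (r * t) <= (2 * s * t) * (2 * a).
    by apply: ler_wpM2l => //; rewrite !mulr_ge0 // ltW.
  by lra.
(* [D] is [r] times a convex combination of the centred constraints, so Jensen's inequality reduces
   the claim to one constraint at a time, whatever their dependence. *)
apply: (@le_trans _ _ (\int[Q]_z (\sum_i (y i / r)%:E * (expR (s * r * (G i z - g i)))%:E))%E).
  apply: ge0_le_integral => //.
  - by apply/measurable_EFinP; exact: mE.
  - apply: emeasurable_sum => i; apply/measurable_EFinP; apply: measurable_funM => //.
    apply: measurableT_comp => //; apply: measurable_funM => //.
    by have [] := DG i.
  move=> z _; under eq_bigr do rewrite -EFinM.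
  rewrite sumEFin lee_fin.
  have -> : s * D z = \sum_i (y i / r) * (s * r * (G i z - g i)).
    by rewrite DE mulr_sumr; apply: eq_bigr => i _; field.
  apply: expR_sum_conv => [i|]; first by rewrite divr_ge0.
  by rewrite -mulr_suml divff.
have mEi i : measurable_fun setT (fun z => (expR (s * r * (G i z - g i)))%:E).
  apply/measurable_EFinP; apply: measurableT_comp => //; apply: measurable_funM => //.
  by have [] := DG i.
rewrite ge0_integral_sum //; last 2 first.
- by move=> i; apply: emeasurable_funM => //; exact: measurable_cst.
- by move=> i z _; rewrite mule_ge0 // lee_fin divr_ge0.
set B := expR (_ * _ ^+ 2).
apply: (@le_trans _ _ (\sum_i (y i / r)%:E * B%:E)%E).
  apply: lee_sum => i _; rewrite ge0_integralZl //; last by rewrite lee_fin divr_ge0.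
  rewrite lee_wpmul2l ?lee_fin ?divr_ge0 //.
  by have [mDi iDi Di0 _] := DG i; exact: subgaussian_mgf.
under eq_bigr do rewrite -EFinM.
by rewrite sumEFin -!mulr_suml -/r divff // mul1r.
Qed.

End subgaussian.

(** * Expectation bounds for adapted recursions and Markov's inequality *)

Section adapted_recursions.
Context {R : realType} d (T : measurableType d) (P : probability T R).
Context d' (Z : measurableType d') (zs : nat -> T -> Z) (Q : probability Z R).
Hypothesis mzs : forall k, measurable_fun setT (zs k).
Hypothesis indep : mutually_independent P zs.
Hypothesis lawQ : forall k (B : set Z), measurable B -> P (zs k @^-1` B) = Q B.

Lemma ae_of_full (N : set T) (p : T -> Prop) : measurable N -> P N = 1%E ->
  (forall w, N w -> p w) -> {ae P, forall w, p w}.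
Proof.
move=> mN PN Np; exists (~` N); split; first exact: measurableC.
  by rewrite probability_setC // PN subee.
by move=> w /= pw Nw; apply: pw; exact: Np.
Qed.

Lemma measurable_pair_now k (h : T -> Z -> R) :
  measurable_fun (setT : set (past zs k * Z)) (fun z => h z.1 z.2) ->
  measurable_fun setT (fun w => h w (zs k w)).
Proof.
move=> mh.
have mid : measurable_fun (setT : set T) (id : T -> past zs k).
  by move=> _ B mB; rewrite setTI; exact: (past_measurable mzs mB).
have mp : measurable_fun (setT : set T) (fun w => ((w : past zs k), zs k w)).
  exact: (@measurable_fun_pair _ _ _ T (past zs k) Z (id : T -> past zs k)).
exact: (measurableT_comp mh mp).
Qed.

(** The summand 1 covers the steps ending below a fixed level, the product covers the others. Since
    the factor [h] has conditional mean at most 1, the expectation grows by at most 1 per step. The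
    event [N] is where all samples lie in the support. *)
Lemma adapted_drift_le (A : nat -> T -> R) (h : nat -> T -> Z -> R) (N : set T) :
  measurable N -> P N = 1%E ->
  (forall k, measurable_fun (setT : set (past zs k)) (A k)) -> (forall k w, 0 <= A k w) ->
  (forall k, measurable_fun (setT : set (past zs k * Z)) (fun z => h k z.1 z.2)) ->
  (forall k w z, 0 <= h k w z) -> (forall k w, (\int[Q]_z (h k w z)%:E <= 1)%E) ->
  (forall w, A 0%N w <= 1) ->
  (forall k w, N w -> A k.+1 w <= 1 + A k w * h k w (zs k w)) ->
  forall k, (\int[P]_w (A k w)%:E <= (k.+1%:R)%:E)%E.
Proof.
move=> mN PN mA A0 mh h0 h1 Ai As.
have mAT k : measurable_fun setT (A k) by exact: past_measurable_fun (mA k).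
elim=> [|k IH].
  apply: (@le_trans _ _ (\int[P]_w (cst 1%:E) w)%E).
    apply: ge0_le_integral => //.
    - by move=> w _; rewrite lee_fin.
    - exact/measurable_EFinP.
    - by move=> w _; rewrite lee_fin.
  by rewrite integral_cst // [X in (_ * X)%E]probability_setT mule1.
have mAh : measurable_fun setT (fun w => A k w * h k w (zs k w)).
  by apply: measurable_funM => //; exact: measurable_pair_now.
have Ah0 w : 0 <= A k w * h k w (zs k w) by exact: mulr_ge0.
apply: (@le_trans _ _ (\int[P]_w (1%:E + (A k w * h k w (zs k w))%:E))%E).
  apply: ae_ge0_le_integral => //.
  - by move=> w _; rewrite lee_fin.
  - exact/measurable_EFinP.
  - by move=> w _; rewrite -EFinD lee_fin addr_ge0.
  - by apply: emeasurable_funD => //; exact/measurable_EFinP.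
  - by apply: (ae_of_full mN PN) => w Nw _; rewrite -EFinD lee_fin; exact: As.
rewrite ge0_integralD //; last 2 first.
- by move=> w _; rewrite lee_fin.
- exact/measurable_EFinP.
rewrite integral_cst // [X in (_ * X)%E]probability_setT mule1.
have -> : (k.+2%:R)%:E = (1 + (k.+1%:R)%:E)%E :> \bar R by rewrite -EFinD nat1r.
rewrite leeD2l //.
apply: le_trans IH; apply: (integral_past_step mzs indep _ (mA k)) => //.
by move=> B mB; exact: lawQ.
Qed.

Lemma adapted_supermartingale_le (A : nat -> T -> R) (h : nat -> T -> Z -> R) :
  (forall k, measurable_fun (setT : set (past zs k)) (A k)) -> (forall k w, 0 <= A k w) ->
  (forall k, measurable_fun (setT : set (past zs k * Z)) (fun z => h k z.1 z.2)) ->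
  (forall k w z, 0 <= h k w z) -> (forall k w, (\int[Q]_z (h k w z)%:E <= 1)%E) ->
  (forall w, A 0%N w = 1) ->
  (forall k w, A k.+1 w = A k w * h k w (zs k w)) ->
  forall k, (\int[P]_w (A k w)%:E <= 1)%E.
Proof.
move=> mA A0 mh h0 h1 Ai As; elim=> [|k IH].
  under eq_integral do rewrite Ai.
  by rewrite integral_cst // [X in (_ * X)%E]probability_setT mule1.
under eq_integral do rewrite As.
apply: le_trans IH; apply: (integral_past_step mzs indep _ (mA k)) => //.
by move=> B mB; exact: lawQ.
Qed.

(** Markov's inequality at level 1: on [N], the indicator of the complement of [S] is at most
    [Y]. *)
Lemma markov_full (Y : T -> R) (b : R) (N S : set T) :
  measurable N -> P N = 1%E -> measurable S ->
  measurable_fun setT Y -> (forall w, 0 <= Y w) -> (\int[P]_w (Y w)%:E <= b%:E)%E ->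
  (forall w, N w -> Y w < 1 -> S w) -> ((1 - b)%:E <= P S)%E.
Proof.
move=> mN PN mS mY Y0 Yb NS.
have mSC : measurable (~` S) by exact: measurableC.
have h : (P (~` S) <= b%:E)%E.
  apply: le_trans Yb; rewrite -[X in (P X <= _)%E]setIT -integral_indic //.
  apply: ae_ge0_le_integral => //.
  - by apply/measurable_EFinP; exact: measurable_indic.
  - by move=> w _; rewrite lee_fin.
  - exact/measurable_EFinP.
  - apply: (ae_of_full mN PN) => w Nw _; rewrite lee_fin indicE.
    case: (boolP (w \in ~` S)) => [|_]; last by rewrite Y0.
    rewrite inE => nS; rewrite leNgt; apply/negP => Y1; exact: nS (NS _ Nw Y1).
have -> : S = ~` ~` S by rewrite setCK.
rewrite probability_setC // EFinB.
by apply: leeB.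
Qed.

End adapted_recursions.

(** * Exponential moments of the constraint noise and of the potential *)

Section slpmm_concentration.
Context {R : realType} d (T : measurableType d) (P : probability T R).
Context d' (Z : measurableType d') (zs : nat -> T -> Z) (Q : probability Z R).
Hypothesis mzs : forall k, measurable_fun setT (zs k).
Hypothesis indep : mutually_independent P zs.
Hypothesis lawQ : forall k (B : set Z), measurable B -> P (zs k @^-1` B) = Q B.
Context (n p : nat) (C : set 'rV[R]_n) (x : nat -> T -> 'rV[R]_n).
Variables (lam : nat -> T -> 'I_p -> R) (G : 'I_p -> 'rV[R]_n -> Z -> R) (a t : R).
Hypothesis Cx : forall k w, C (x k w).
Hypothesis mx : forall k j, measurable_fun (setT : set (past zs k)) (fun w => x k w 0 j).
Hypothesis mlam : forall k i, measurable_fun (setT : set (past zs k)) (fun w => lam k w i).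
Hypothesis lam0 : forall k w i, 0 <= lam k w i.
Hypothesis mG : forall i u, C u -> measurable_fun setT (G i u).
Hypothesis cG : forall i z, seq_continuous_on C (fun u => G i u z).
Hypothesis Ga : forall u z, C u -> Num.sqrt (\sum_i G i u z ^+ 2) <= a.

Let g i u := fine (\int[Q]_z (G i u z)%:E).

Hypotheses (a0 : 0 < a) (t0 : 0 < t).
Hypothesis hG : forall i u, C u ->
  (\int[Q]_z (expR ((G i u z - g i u) ^+ 2 / t ^+ 2))%:E <= (expR 1)%:E)%E.

Lemma G_abs_le i u z : C u -> `|G i u z| <= a.
Proof.
move=> Cu; apply: le_trans (Ga z Cu).
rewrite -sqrtr_sqr ler_sqrt ?sum_sqr_ge0 // (bigD1 i) //= lerDl sumr_ge0 // => j _.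
exact: sqr_ge0.
Qed.

(** Dominated convergence with the constant majorant [a]. *)
Lemma g_seq_continuous i : seq_continuous_on C (g i).
Proof.
move=> y u Cy Cu yu.
have mGE v : C v -> measurable_fun setT (EFin \o G i v).
  by move=> Cv; apply/measurable_EFinP; exact: mG.
have cv : {ae Q, forall z, setT z -> (G i (y m) z)%:E @[m --> \oo] --> (G i u z)%:E}.
  by apply: aeW => z _; apply: cvg_EFin; [exact: nearW|exact: cG].
have dom : {ae Q, forall z, forall m, setT z -> (`|(G i (y m) z)%:E| <= cst a%:E z)%E}.
  by apply: aeW => z m _; rewrite lee_fin; exact: G_abs_le.
have [_ _ h] := dominated_convergence measurableT (fun m => mGE _ (Cy m)) (mGE _ Cu)
  cv (finite_measure_integrable_cst Q a measurableT) dom.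
apply: fine_cvg; rewrite fineK; first exact: h.
apply: integrable_fin_num => //.
exact: bounded_integrable (mG i Cu) (fun z => G_abs_le i z Cu).
Qed.

Lemma g_convex i : convex_set C -> (forall z, convex_on C (fun u => G i u z)) ->
  convex_on C (g i).
Proof.
move=> cC cvG u v l Cu Cv l01.
have Cw := convex_setP cC Cu Cv l01.
have iG y : C y -> Q.-integrable setT (EFin \o G i y).
  by move=> Cy; exact: bounded_integrable (mG i Cy) (fun z => G_abs_le i z Cy).
have iZ c y : C y -> Q.-integrable setT (EFin \o (fun z => c * G i y z)).
  move=> Cy; have := integrableZl measurableT c (iG _ Cy).
  by apply: eq_integrable => // z _; rewrite /= EFinM.
rewrite /g -/(Rintegral Q setT (G i _)) -/(Rintegral Q setT (G i u)) -/(Rintegral Q setT (G i v)).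
rewrite -!RintegralZl //; [|exact: iG|exact: iG].
rewrite -RintegralD //; [|exact: iZ|exact: iZ].
apply: le_Rintegral => //; first exact: iG.
  have := integrableD measurableT (iZ l _ Cu) (iZ (1 - l) _ Cv).
  by apply: eq_integrable => // z _; rewrite /= EFinD.
by move=> z _; exact: cvG.
Qed.

Lemma measurable_g d1 (T1 : measurableType d1) (U : T1 -> 'rV[R]_n) i :
  (forall w, C (U w)) -> (forall j, measurable_fun setT (fun w => U w 0 j)) ->
  measurable_fun setT (fun w => g i (U w)).
Proof.
move=> CU mU; apply: (measurable_comp_caratheodory CU mU (H := fun u _ => g i u)).
  by move=> u _; exact: measurable_cst.
by move=> w; exact: g_seq_continuous.
Qed.

Lemma past_mono_fun j k d1 (T1 : measurableType d1) (f : T -> T1) : (j <= k)%N ->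
  measurable_fun (setT : set (past zs j)) f -> measurable_fun (setT : set (past zs k)) f.
Proof.
move=> jk mf _ B mB; rewrite setTI.
have := mf measurableT _ mB; rewrite setTI.
elim: k jk => [|k IH]; first by rewrite leqn0 => /eqP ->.
rewrite leq_eqVlt => /orP[/eqP -> //|jk h]; apply: past_mono; exact: IH.
Qed.

Lemma measurable_G_now k i :
  measurable_fun (setT : set (past zs k * Z)) (fun q => G i (x k q.1) q.2).
Proof.
apply: (@measurable_comp_caratheodory _ _ _ _ C (fun q : past zs k * Z => x k q.1)
  (fun u q => G i u q.2)).
- by move=> q; exact: Cx.
- move=> j; exact: (measurableT_comp (@mx k j) measurable_fst).
- by move=> u Cu; exact: (measurableT_comp (mG i Cu) measurable_snd).
- by move=> q; exact: cG.
Qed.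

Lemma measurable_G_past j k i : (j < k)%N ->
  measurable_fun (setT : set (past zs k)) (fun w => G i (x j w) (zs j w)).
Proof.
move=> jk; have mz : measurable_fun (setT : set (past zs k)) (zs j).
  by move=> _ B mB; rewrite setTI; exact: past_xs.
apply: (@measurable_comp_caratheodory _ _ _ _ C (x j : past zs k -> _)
  (fun u w => G i u (zs j w))).
- exact: Cx.
- by move=> l; apply: (past_mono_fun (ltnW jk)); exact: mx.
- by move=> u Cu; exact: (measurableT_comp (mG i Cu) mz).
- by move=> w; exact: cG.
Qed.

Definition noise i j w := g i (x j w) - G i (x j w) (zs j w).

Lemma measurable_noise i j k : (j < k)%N ->
  measurable_fun (setT : set (past zs k)) (noise i j).
Proof.
move=> jk; apply: measurable_funB; last exact: measurable_G_past.
apply: measurable_g => [w|l]; first exact: Cx.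
by apply: (past_mono_fun (ltnW jk)); exact: mx.
Qed.

(** The exponential is a product of adapted factors; the discount [2 * c ^+ 2 * t ^+ 2] per step is
    exactly the exponent in [subgaussian_mgf], so each factor has conditional mean at most 1. *)
Lemma noise_mgf i (c : R) k :
  (\int[P]_w (expR (c * \sum_(j < k) noise i j w - k%:R * (2 * c ^+ 2 * t ^+ 2)))%:E <= 1)%E.
Proof.
pose A k w := expR (c * \sum_(j < k) noise i j w - k%:R * (2 * c ^+ 2 * t ^+ 2)).
pose h k (w : T) z := expR (c * (g i (x k w) - G i (x k w) z) - 2 * c ^+ 2 * t ^+ 2).
apply: (@adapted_supermartingale_le _ _ _ P _ _ zs Q mzs indep lawQ A h).
- move=> m; apply: measurableT_comp => //; apply: measurable_funB => //.
  apply: measurable_funM => //; apply: measurable_sum => j.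
  exact: measurable_noise.
- by move=> m w; exact: expR_ge0.
- move=> m; apply: measurableT_comp => //; apply: measurable_funB => //.
  apply: measurable_funM => //; apply: measurable_funB; last exact: measurable_G_now.
  apply: (@measurable_g _ _ (fun q : past zs m * Z => x m q.1)) => [q|j]; first exact: Cx.
  exact: (measurableT_comp (@mx m j) measurable_fst).
- by move=> m w z; exact: expR_ge0.
- move=> m w; rewrite /h.
  have Cu := Cx m w; set u := x m w in Cu *.
  have [mD iD D0 _] := bounded_centered Q (mG i Cu) (fun z => G_abs_le i z Cu).
  have := subgaussian_mgf (- c) t0 mD iD D0 (hG i Cu).
  rewrite sqrrN; set v := 2 * c ^+ 2 * t ^+ 2 => hv.
  apply: (@le_trans _ _ (\int[Q]_z ((expR (- v))%:E * (expR (- c * (G i u z - g i u)))%:E))%E).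
    rewrite le_eqVlt; apply/orP; left; apply/eqP; apply: eq_integral => z _.
    by rewrite -EFinM -expRD; congr (expR _)%:E; ring.
  rewrite ge0_integralZl //; last first.
    apply/measurable_EFinP; apply: measurableT_comp => //; exact: measurable_funM.
  apply: (@le_trans _ _ ((expR (- v))%:E * (expR v)%:E)%E); first by rewrite lee_wpmul2l.
  by rewrite -EFinM -expRD addNr expR0.
- by move=> w; rewrite /A big_ord0 mulr0 mul0r subr0 expR0.
- move=> m w; rewrite /A /h big_ord_recr /= -expRD -natr1 /noise; congr expR; ring.
Qed.

(** The Euclidean norm of the pair (multipliers, displacement from [xh]). The norm, unlike its
    square, rises by a bounded amount per step, so its exponential can be controlled. *)
Definition potential xh k w :=
  Num.sqrt (\sum_i lam k w i ^+ 2 + enorm (xh - x k w) ^+ 2).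

Lemma measurable_potential xh k : measurable_fun (setT : set (past zs k)) (potential xh k).
Proof.
apply: (measurableT_comp (continuous_measurable_fun (@sqrt_continuous R))).
apply: measurable_funD.
  by apply: measurable_sum => i; apply: measurable_funX; exact: mlam.
rewrite (_ : (fun w => enorm (xh - x k w) ^+ 2) =
  fun w => \sum_j (xh 0 j - x k w 0 j) ^+ 2); last first.
  by apply/funext => w; rewrite enorm_sqr; apply: eq_bigr => j _; rewrite !mxE.
apply: measurable_sum => j; apply: measurable_funX; exact: measurable_funB.
Qed.

Lemma potential_sqr xh k w :
  potential xh k w ^+ 2 = \sum_i lam k w i ^+ 2 + enorm (xh - x k w) ^+ 2.
Proof. by rewrite sqr_sqrtr // addr_ge0 ?sqr_ge0 // sum_sqr_ge0. Qed.

(** Either the next potential is below [l2] and its exponential is at most 1, or the increment is a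
    weighted sum of constraints at [xh]. The weights [lam / potential] have Euclidean norm at most
    1, so [drift_mgf] applies with exponent [th * s]. *)
Lemma potential_mgf xh (e th s l2 : R) (N : set T) : measurable N -> P N = 1%E ->
  C xh -> 0 < e -> 0 <= th -> 0 <= s -> th * s * (8 * a * t) <= e ->
  (forall i, g i xh <= - e) ->
  (forall w, potential xh 0 w <= l2) ->
  (forall k w, N w -> potential xh k.+1 w <= l2 \/
     potential xh k.+1 w <= potential xh k w
       + s * \sum_i lam k w i / potential xh k w * (G i xh (zs k w) + e / 2)) ->
  forall k, (\int[P]_w (expR (th * (potential xh k w - l2)))%:E <= (k.+1%:R)%:E)%E.
Proof.
move=> mN PN Cxh e0 th0 s0 ths ge pot0 potS.
pose h k (w : T) z :=
  expR (th * s * \sum_i lam k w i / potential xh k w * (G i xh z + e / 2)).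
apply: (@adapted_drift_le _ _ _ P _ _ zs Q mzs indep lawQ _ h N) => //.
- move=> k; apply: measurableT_comp => //; apply: measurable_funM => //.
  by apply: measurable_funB => //; exact: measurable_potential.
- move=> k; apply: measurableT_comp => //; apply: measurable_funM => //.
  apply: measurable_sum => i; apply: measurable_funM; last first.
    apply: measurable_funD => //.
    exact: (measurableT_comp (mG i Cxh) measurable_snd).
  have mf : measurable_fun (setT : set (past zs k)) (fun w => lam k w i / potential xh k w).
    apply: measurable_funM => //.
    rewrite (_ : (fun w => _) = fun w => powR (potential xh k w) (-1)); last first.
      by apply/funext => w; rewrite powR_inv1 // sqrtr_ge0.
    apply: (measurableT_comp (measurable_powR (-1))).
    exact: measurable_potential.
  exact: (measurableT_comp mf measurable_fst).
- by move=> k w z; exact: expR_ge0.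
- move=> k w; apply: (@drift_mgf _ _ _ Q p (fun i => lam k w i / potential xh k w)
    (fun i => G i xh) a e t (th * s)) => //.
  + by rewrite mulr_ge0.
  + by move=> i; rewrite divr_ge0 // sqrtr_ge0.
  (* At zero potential the inverse is 0 by convention, and so are all weights. *)
  + have [L0|L0] := eqVneq (potential xh k w) 0.
      by rewrite big1 // => i _; rewrite L0 invr0 mulr0 expr0n.
    have L2 : 0 < potential xh k w ^+ 2 by rewrite exprn_gt0 // lt0r L0 sqrtr_ge0.
    under eq_bigr do rewrite expr_div_n.
    by rewrite -mulr_suml ler_pdivrMr // mul1r potential_sqr lerDl sqr_ge0.
  + by move=> i; exact: mG.
  + by move=> z; exact: Ga.
  + by move=> i; exact: hG.
- by move=> w; rewrite expR_le1 mulr_ge0_le0 // subr_le0.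
- move=> k w Nw; rewrite /h -expRD.
  have [h1|h1] := potS k w Nw.
    apply: (@le_trans _ _ 1); last by rewrite lerDl expR_ge0.
    by rewrite expR_le1 mulr_ge0_le0 // subr_le0.
  rewrite -[leLHS]add0r; apply: lerD => //; rewrite ler_expR.
  by have := ler_wpM2l th0 h1; lra.
Qed.

End slpmm_concentration.

(** * Changing an integrand outside the support of the law *)

Section law_support.
Context {R : realType} d (T : measurableType d) (P : probability T R).
Context d' (Z : measurableType d') (X : {RV P >-> Z}) (S : set Z).
Hypotheses (mS : measurable S) (PS : P (X @^-1` S) = 1%E).

Let mXS : measurable (X @^-1` S).
Proof. by rewrite -[X in measurable X]setTI; exact: measurable_funP. Qed.

Lemma ge0_integral_law_support (f f' : Z -> \bar R) :
  measurable_fun setT f -> measurable_fun setT f' ->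
  (forall z, 0 <= f z)%E -> (forall z, S z -> f z = f' z) ->
  (\int[distribution P X]_z f z = \int[P]_w f' (X w))%E.
Proof.
move=> mf mf' f0 ff'; rewrite ge0_integral_distribution //.
apply: ae_eq_integral => //.
- exact: measurableT_comp.
- exact: (measurableT_comp mf' (measurable_funP X)).
- by apply: (ae_of_full mXS PS) => w Sw _ /=; exact: ff'.
Qed.

Lemma integral_law_support (f f' : Z -> R) (M : R) :
  measurable_fun setT f -> measurable_fun setT f' ->
  (forall z, `|f z| <= M) -> (forall z, S z -> f z = f' z) ->
  (\int[distribution P X]_z (f z)%:E = \int[P]_w (f' (X w))%:E)%E.
Proof.
move=> mf mf' fM ff'; have mfX : measurable_fun setT (fun w => f (X w)).
  exact: (measurableT_comp mf (measurable_funP X)).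
rewrite integral_distribution //; last exact: (bounded_integrable P mfX (fun w => fM (X w))).
  apply: ae_eq_integral => //.
  - exact/measurable_EFinP.
  - apply/measurable_EFinP; exact: (measurableT_comp mf' (measurable_funP X)).
  - by apply: (ae_of_full mXS PS) => w Sw _ /=; rewrite ff'.
exact/measurable_EFinP.
Qed.

End law_support.

Lemma probability_bigcap1 (R : realType) d (T : measurableType d) (P : probability T R)
    (E : nat -> set T) : (forall k, measurable (E k)) -> (forall k, P (E k) = 1%E) ->
  measurable (\bigcap_k E k) /\ P (\bigcap_k E k) = 1%E.
Proof.
move=> mE PE; have mI : measurable (\bigcap_k E k) by exact: bigcapT_measurable.
split=> //; have : P.-negligible (~` \bigcap_k E k).
  rewrite setC_bigcap; apply: negligible_bigcup => k.
  exists (~` E k); split; [exact: measurableC| |by []].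
  by have := probability_setC P (mE k); rewrite PE subee.
move=> /(measure_negligible (measurableC mI)) h.
by have := probability_setC P (measurableC mI); rewrite setCK h sube0.
Qed.

(** * Constants and averages *)

Section constants.
Context {R : realType}.

Lemma sqrt_sum_le_sum (p : nat) (y : 'I_p -> R) : (forall i, 0 <= y i) ->
  Num.sqrt (\sum_i y i ^+ 2) <= \sum_i y i.
Proof.
move=> y0; set r := \sum_i y i; have r0 : 0 <= r by exact: sumr_ge0.
rewrite -[leRHS]ger0_norm // -sqrtr_sqr ler_sqrt ?sqr_ge0 //.
rewrite expr2 {1}/r mulr_suml; apply: ler_sum => i _.
by rewrite expr2 ler_wpM2l // /r (bigD1 i) //= lerDl sumr_ge0.
Qed.

(** Below the level [l1] one step cannot climb past [l1 + 2 * a]. Above it, the multipliers are so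
    large that half of Slater's margin absorbs [c0]; the other half is what remains as negative
    drift. *)
Lemma potential_step (p : nat) (lam Gh : 'I_p -> R) (a e s c0 Rd X Phi1 : R) :
  0 < e -> e <= a -> 0 < s <= 1 -> 0 < c0 -> 0 <= Rd -> 0 <= X <= Rd ->
  (forall i, 0 <= lam i) -> Num.sqrt (\sum_i Gh i ^+ 2) <= a -> 0 <= Phi1 ->
  let L := Num.sqrt (\sum_i lam i ^+ 2 + X ^+ 2) in
  let l1 := 2 * c0 / e + Rd in
  Phi1 <= \sum_i lam i ^+ 2 + X ^+ 2 + 2 * s * (c0 + \sum_i lam i * Gh i) ->
  Num.sqrt Phi1 <= l1 + 2 * a \/
  Num.sqrt Phi1 <= L + s * \sum_i lam i / L * (Gh i + e / 2).
Proof.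
move=> e0 ea /andP[s0 s1] c00 R0 /andP[X0 XR] lam0 Gha Phi10 L l1 h.
have a0 : 0 < a by exact: lt_le_trans ea.
have sq0 := sum_sqr_ge0 lam.
have L0 : 0 <= L by exact: sqrtr_ge0.
have L2 : L ^+ 2 = \sum_i lam i ^+ 2 + X ^+ 2 by rewrite sqr_sqrtr // addr_ge0 ?sqr_ge0.
have c0e : 0 < 2 * c0 / e by rewrite divr_gt0 // mulr_gt0.
have l10 : 0 < l1 by rewrite ltr_wpDr.
have c0l1 : 2 * c0 <= e * l1.
  by rewrite /l1 mulrDr mulrCA mulfV ?lt0r_neq0 // mulr1 lerDl mulr_ge0 // ltW.
set M := \sum_i lam i * Gh i in h.
set q := \sum_i lam i ^+ 2 in h L2 sq0.
have q2 : Num.sqrt q ^+ 2 = q by rewrite sqr_sqrtr.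
have q0 : 0 <= Num.sqrt q by exact: sqrtr_ge0.
have qL : Num.sqrt q <= L by rewrite ler_sqrt ?addr_ge0 ?sqr_ge0 // lerDl sqr_ge0.
have Mle : M <= Num.sqrt q * a.
  by apply: le_trans (cauchy_schwarz_sum _ _) _; rewrite ler_wpM2l.
have [Ll|Ll] := ltP L l1; [left|right].
  have l1a : 0 <= l1 + 2 * a by rewrite addr_ge0 // ltW // mulr_gt0.
  rewrite -[leRHS]ger0_norm // -sqrtr_sqr ler_sqrt ?sqr_ge0 //.
  apply: le_trans h _; rewrite -L2.
  have h1 : L ^+ 2 <= l1 ^+ 2 by rewrite ler_sqr ?nnegrE ?(ltW Ll) // ltW.
  have h2 : M <= l1 * a.
    by apply: le_trans Mle _; rewrite ler_wpM2r ?(ltW a0) // (le_trans qL) // ltW.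
  have h3 : 2 * c0 <= a * l1 by apply: le_trans c0l1 _; rewrite ler_wpM2r // ltW.
  (* From [2 * c0 <= a * l1] and [M <= a * l1]; the result fits into the cross term [4 * a * l1] of
     [(l1 + 2 * a) ^+ 2]. *)
  have h4 : 2 * s * (c0 + M) <= 3 * (a * l1).
    apply: (@le_trans _ _ (s * (3 * (a * l1)))).
      have -> : 2 * s * (c0 + M) = s * (2 * (c0 + M)) by ring.
      by rewrite ler_wpM2l ?(ltW s0) //; lra.
    by rewrite ler_piMl // mulr_ge0 // mulr_ge0 // ltW.
  have h5 : 0 <= a * l1 by rewrite mulr_ge0 // ltW.
  have h6 : 0 <= a ^+ 2 by exact: sqr_ge0.
  by rewrite sqrrD; lra.
have Lp : 0 < L by exact: lt_le_trans Ll.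
(* [L >= l1] and [X <= Rd] force the multiplier norm above [2 * c0 / e]: the summand [Rd] in [l1]
   compensates for the displacement [X]. The l1-norm is larger still. *)
have lamc : c0 <= e / 2 * \sum_i lam i.
  have h1 : 2 * c0 / e <= Num.sqrt q.
    rewrite -[leLHS]ger0_norm ?(ltW c0e) // -sqrtr_sqr ler_sqrt //.
    have : l1 ^+ 2 <= L ^+ 2 by rewrite ler_sqr ?nnegrE // ltW.
    have : X ^+ 2 <= Rd ^+ 2 by rewrite ler_sqr ?nnegrE.
    have : 0 <= 2 * c0 / e * Rd by rewrite mulr_ge0 // ltW.
    by rewrite /l1 sqrrD L2 -/q mulr2n; lra.
  have h2 := le_trans h1 (sqrt_sum_le_sum lam0).
  rewrite ler_pdivrMr // in h2; lra.
(* The square root is linearised by its tangent: the root of [L ^+ 2 + dl] is at most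
   [L + dl / (2 * L)]. *)
pose dl := 2 * s * (c0 + M).
have h1 : L + dl / (2 * L) <= L + s * \sum_i lam i / L * (Gh i + e / 2).
  rewrite lerD2l /dl.
  have -> : \sum_i lam i / L * (Gh i + e / 2) = (M + e / 2 * \sum_i lam i) / L.
    by rewrite mulr_sumr -big_split /= mulr_suml; apply: eq_bigr => i _; ring.
  have -> : 2 * s * (c0 + M) / (2 * L) = s * ((c0 + M) / L).
    by field; rewrite lt0r_neq0.
  by rewrite ler_wpM2l ?(ltW s0) // ler_wpM2r ?invr_ge0 // addrC lerD2l.
apply: le_trans h1.
have h0 : 0 <= L ^+ 2 + dl by apply: le_trans Phi10 _; rewrite L2.
have hz : 0 <= L + dl / (2 * L).
  have -> : L + dl / (2 * L) = (L ^+ 2 + (L ^+ 2 + dl)) / (2 * L).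
    by field; rewrite lt0r_neq0.
  by apply: divr_ge0; [exact: addr_ge0 (sqr_ge0 _) h0|exact: mulr_ge0].
rewrite -[leRHS]ger0_norm // -sqrtr_sqr ler_sqrt ?sqr_ge0 //.
apply: le_trans h _; rewrite -/dl -L2.
have -> : (L + dl / (2 * L)) ^+ 2 = L ^+ 2 + dl + (dl / (2 * L)) ^+ 2.
  by field; rewrite lt0r_neq0.
by rewrite lerDl sqr_ge0.
Qed.

(* The logarithm in [kappa3] leaves a margin of [48 b^2 / e]: 32 of these pay for
   the fluctuation of the multipliers and 16 for that of the constraints. *)
Lemma kappa3_ge (b e : R) : 0 < e -> e <= b ->
  4 * b + e + 48 * (b ^+ 2 / e) <= 2 * kappa3 b e.
Proof.
move=> e0 eb; have b0 : 0 < b by exact: lt_le_trans eb.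
rewrite /kappa3.
have m0 : 0 <= b ^+ 2 / e by rewrite divr_ge0 ?sqr_ge0 // ltW.
have : 3 <= ln (32 * b ^+ 2 / e ^+ 2).
  apply: le_trans (ln32_ge3 R) _; rewrite ler_ln ?posrE //; last first.
    by rewrite divr_gt0 ?exprn_gt0 // mulr_gt0 // exprn_gt0.
  rewrite -mulrA ler_peMr // ler_pdivlMr ?exprn_gt0 // mul1r ler_sqr ?nnegrE //; exact: ltW.
move=> /(ler_wpM2l m0) h.
have -> : 8 * b ^+ 2 / e = 8 * (b ^+ 2 / e) by ring.
by lra.
Qed.

Variables (p : nat) (a kf kg Rd e sc : R).
Hypotheses (e0 : 0 < e) (ea : e <= a) (kf0 : 0 <= kf) (kg0 : 0 <= kg) (R0 : 0 <= Rd).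
Local Notation b := (beta0 p a kg Rd).
Local Notation w := (1 + Num.sqrt p%:R * kg ^+ 2).

Lemma beta0_ge : a <= b.
Proof. by rewrite /beta0 lerDl !mulr_ge0 ?sqrtr_ge0. Qed.

Local Notation thr S rho := ((theta1 p kg sc b e * rho + theta2 p kf kg Rd e b
   + theta3 p kg b e * ln (S ^+ 2 + 1)) / S + theta4 p a kg e b / S ^+ 2).

(** The left side lists what the analysis produces: noise and step lengths, the term of order
    [1 / S ^+ 2], the multiplier level times [w], and a surplus [16 * (b ^+ 2 / e) - 8 * t] that
    pays for the constant 8 in the noise term. *)
Lemma threshold_ge (S rho t : R) : 1 <= S -> 0 <= rho -> 0 <= t <= sc ->
  (t * (rho + 8) + kg * kf) / S + Num.sqrt p%:R * kg ^+ 2 * a / S ^+ 2 +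
  w * (2 * (kf * Rd + S^-1 * a ^+ 2 / 2) / e + Rd + 2 * a + 32 * (b ^+ 2 / e)) / S
  + (16 * (b ^+ 2 / e) - 8 * t) / S <= thr S rho.
Proof.
move=> S1 rho0 /andP[t0 tsc].
have S0 : 0 < S by apply: lt_le_trans S1.
have := R0; have := e0; have := ea => ea1 e01 R01.
have ab := beta0_ge; have eb := le_trans ea ab.
have a0 : 0 < a by exact: lt_le_trans ea.
have b0 : 0 < b by exact: lt_le_trans ab.
have hk := kappa3_ge e0 eb.
have w1 : 1 <= w by rewrite lerDl mulr_ge0 ?sqrtr_ge0 ?sqr_ge0.
rewrite -subr_ge0.
set k3 := kappa3 b e in hk.
rewrite /theta1 /theta2 /theta3 /theta4 -/k3 /kappa0 /kappa1 /kappa2.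
have -> : Num.sqrt p%:R * a * kg ^+ 2 = Num.sqrt p%:R * kg ^+ 2 * a by ring.
move: (Num.sqrt p%:R * kg ^+ 2) w1 => W w1.
have ln0 : 0 <= ln (S ^+ 2 + 1) by rewrite ln_ge0 // lerDr sqr_ge0.
move: (ln _) ln0 => l l0.
have i0 : 0 < S^-1 by rewrite invr_gt0.
have i1 : S^-1 <= 1 by rewrite invf_le1.
have m0 : 0 <= b ^+ 2 / e by rewrite divr_ge0 ?sqr_ge0 // ltW.
(* The level contains [Rd] while [theta2] offers [kappa1], which is [Rd ^+ 2 / e]; the missing [e]
   comes out of [kappa3]. *)
have Re : Rd <= Rd ^+ 2 / e + e.
  have : 0 <= (Rd - e) ^+ 2 / e by rewrite divr_ge0 ?sqr_ge0 // ltW.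
  have -> : (Rd - e) ^+ 2 / e = Rd ^+ 2 / e + e - 2 * Rd by field; rewrite lt0r_neq0.
  by lra.
have ib : S^-1 * b <= b by rewrite ler_piMl // ltW.
(* The term [S^-1 * b] comes from the negative part of [kappa2]; together with [2 * a] it is covered
   by the [4 * b] of [kappa3_ge]. *)
have key : 16 * (b ^+ 2 / e) <=
    Rd ^+ 2 / e + 2 * k3 - Rd - 2 * a - 32 * (b ^+ 2 / e) - S^-1 * b by lra.
set k := _ - S^-1 * b in key.
have W0 : 0 <= 1 + W by lra.
have -> : forall z1 z2 : R, z1 - z2 = S^-1 * (S * (z1 - z2)).
  by move=> z1 z2; rewrite mulrA mulVf ?mul1r // lt0r_neq0.
apply: mulr_ge0; first exact: ltW.
have h1 : 0 <= (sc - t) * rho by rewrite mulr_ge0 // subr_ge0.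
have h2 : 0 <= (1 + W) * (16 * b / e * (rho + l)).
  by rewrite mulr_ge0 // mulr_ge0 ?addr_ge0 // divr_ge0 ?mulr_ge0 // ltW.
have h3 : 16 * (b ^+ 2 / e) <= (1 + W) * k.
  have k0 : 0 <= k by apply: le_trans key; rewrite mulr_ge0.
  by apply: (le_trans key); rewrite ler_peMl // lerDl; lra.
pose x := (sc - t) * rho + (1 + W) * (16 * b / e * (rho + l))
   + ((1 + W) * k - 16 * (b ^+ 2 / e)).
have x0 : 0 <= x by rewrite /x; lra.
apply: le_trans x0 _; rewrite le_eqVlt; apply/orP; left; apply/eqP.
by rewrite /x /k; field; rewrite !lt0r_neq0.
Qed.

(** For the parameters at which the threshold exceeds the uniform bound on the constraints, so that
    there is nothing to prove. *)
Lemma threshold_ge_trivial (S rho t : R) : 1 <= S -> 0 <= rho -> 0 <= t <= sc ->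
  (t * rho + 48 * (b ^+ 2 / e)) / S <= thr S rho.
Proof.
move=> S1 rho0 t01; apply: le_trans (threshold_ge S1 rho0 t01).
have S0 : 0 < S by apply: lt_le_trans S1.
have a0 : 0 <= a by rewrite ltW // (lt_le_trans e0).
have i0 : 0 <= S^-1 by rewrite invr_ge0 ltW.
have W0 : 0 <= Num.sqrt p%:R * kg ^+ 2 by rewrite mulr_ge0 ?sqrtr_ge0 ?sqr_ge0.
have m0 : 0 <= b ^+ 2 / e by rewrite divr_ge0 ?sqr_ge0 // ltW.
have h1 : 0 <= Num.sqrt p%:R * kg ^+ 2 * a / S ^+ 2.
  by apply: divr_ge0; [exact: mulr_ge0|exact: sqr_ge0].
have h2 : 32 * (b ^+ 2 / e) <=
    w * (2 * (kf * Rd + S^-1 * a ^+ 2 / 2) / e + Rd + 2 * a + 32 * (b ^+ 2 / e)).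
  have h3 : 0 <= 2 * (kf * Rd + S^-1 * a ^+ 2 / 2) / e.
    apply: divr_ge0; last exact: ltW.
    rewrite mulr_ge0 // addr_ge0 ?mulr_ge0 // divr_ge0 // mulr_ge0 // sqr_ge0 //.
  have := R0 => R01; move: (_ / e) h3 => z h3.
  apply: (@le_trans _ _ (z + Rd + 2 * a + 32 * (b ^+ 2 / e))); first by lra.
  by rewrite ler_peMl ?lerDl //; lra.
have h4 : 0 <= kg * kf by rewrite mulr_ge0.
move: h2; set z := w * _ => h2.
have h5 : t * rho + 48 * (b ^+ 2 / e) <=
   (t * (rho + 8) + kg * kf) + z + (16 * (b ^+ 2 / e) - 8 * t) by lra.
by move: (ler_wpM2r i0 h5); rewrite !mulrDl; lra.
Qed.

End constants.

(** The multiplier increments telescope to [mu K], and each of the [K] step lengths is of order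
    [1 / S]; since [K = S ^+ 2], both contributions are of order [S]. *)
Lemma sum_constraint_le (R : realType) (K : nat) (S kf kg q a L : R)
    (Gj mu dl Lm : nat -> R) :
  0 < S -> S ^+ 2 = K%:R -> 0 <= kg -> 0 <= q ->
  (forall j, (j < K)%N -> Gj j <= S * (mu j.+1 - mu j) + kg * dl j) ->
  (forall j, (j < K)%N -> S * dl j <= kf + q * (Lm j + S^-1 * a)) ->
  (forall j, (j < K)%N -> Lm j <= L) -> mu 0%N = 0 -> mu K <= L ->
  \sum_(j < K) Gj j <= S * (L + kg * kf + kg * q * L) + kg * q * a.
Proof.
move=> S0 SK kg0 q0 HG Hdl HL mu0 muK.
pose B := kf + q * (L + S^-1 * a).
apply: (@le_trans _ _ (\sum_(j < K) (S * (mu j.+1 - mu j) + kg * (S^-1 * B)))).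
  apply: ler_sum => j _; apply: le_trans (HG _ (ltn_ord j)) _; rewrite lerD2l ler_wpM2l //.
  rewrite -ler_pdivrMl ?invr_gt0 // invrK; apply: le_trans (Hdl _ (ltn_ord j)) _.
  by rewrite lerD2l ler_wpM2l // lerD2r; exact: HL.
rewrite big_split /= -mulr_sumr sumr_const card_ord -mulr_natl -SK.
rewrite -(big_mkord xpredT (fun j => mu j.+1 - mu j)) telescope_sumr // mu0 subr0.
have h : S * mu K <= S * L by rewrite ler_pM2l.
have -> : S ^+ 2 * (kg * (S^-1 * B)) = S * (kg * kf + kg * q * L) + kg * q * a.
  by rewrite /B; field; rewrite lt0r_neq0.
by lra.
Qed.

Lemma convex_avg (R : realType) n (C : set 'rV[R]_n) (h : 'rV[R]_n -> R) (x : nat -> 'rV[R]_n) :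
  convex_set C -> convex_on C h -> (forall j, C (x j)) -> forall K, (0 < K)%N ->
  C (K%:R^-1 *: \sum_(j < K) x j) /\
  h (K%:R^-1 *: \sum_(j < K) x j) <= K%:R^-1 * \sum_(j < K) h (x j).
Proof.
move=> cC ch Cx; elim=> [//|K IH] _.
have [->|K0] := posnP K.
  by rewrite !big_ord1 invr1 scale1r mul1r.
have [CK hK] := IH K0.
have Kn : K%:R != 0 :> R by rewrite pnatr_eq0 -lt0n.
have K1n : K%:R + 1 != 0 :> R by rewrite natr1 pnatr_eq0.
pose t : R := K%:R / K.+1%:R.
have t01 : 0 <= t <= 1.
  by rewrite divr_ge0 //= ler_pdivrMr // mul1r ler_nat.
have s1 : 1 - t = K.+1%:R^-1 by rewrite /t -natr1; field.
have tK : t * K%:R^-1 = K.+1%:R^-1 by rewrite /t -natr1; field; rewrite K1n Kn.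
have -> : K.+1%:R^-1 *: \sum_(j < K.+1) x j =
    t *: (K%:R^-1 *: \sum_(j < K) x j) + (1 - t) *: x K.
  by rewrite big_ord_recr /= scalerDr s1 scalerA tK.
split; first exact: convex_setP.
apply: le_trans (ch _ _ _ CK (Cx K) t01) _.
rewrite big_ord_recr /= mulrDr s1 lerD2r -tK.
have t0 : 0 <= t by case/andP: t01.
by move: (ler_wpM2l t0 hK); rewrite mulrA.
Qed.

Unset Implicit Arguments.
Set Strict Implicit.
Set Printing Implicit Defensive.

Theorem theorem2 (R : realType) (d : measure_display) (Omega : measurableType d)
  (P : probability Omega R) (n p q : nat)
  (C : set 'rV[R]_n) (Xi : set (q.-tuple R))
  (xi : Omega -> q.-tuple R) (xis : nat -> Omega -> q.-tuple R)
  (F : 'rV[R]_n -> q.-tuple R -> R) (G : 'I_p -> 'rV[R]_n -> q.-tuple R -> R)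
  (v0 : 'rV[R]_n -> q.-tuple R -> 'rV[R]_n)
  (v : 'I_p -> 'rV[R]_n -> q.-tuple R -> 'rV[R]_n)
  (Rd nu_g kappa_f kappa_g eps0 sigma_c : R) (xhat x0 : 'rV[R]_n) (K : nat)
  (xs : nat -> Omega -> 'rV[R]_n) (lams : nat -> Omega -> 'I_p -> R) :
  (* C : nonempty compact convex set *)
  (exists x, C x) -> compact C -> convex_set C ->
  (* xi is a random vector whose distribution is supported on Xi *)
  measurable Xi -> measurable_fun setT xi -> P (xi @^-1` Xi) = 1%E ->
  (* xi^0, xi^1, ... are i.i.d. copies of xi *)
  (forall k, measurable_fun setT (xis k)) ->
  identically_distributed P xi xis -> mutually_independent P xis ->
  (* convexity / continuity in x *)
  (forall z, Xi z -> convex_on C (fun x => F x z) /\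
                     {within C, continuous (fun x => F x z)}) ->
  (forall i z, Xi z -> convex_on C (fun x => G i x z) /\
                       {within C, continuous (fun x => G i x z)}) ->
  (* F(x,.), G_i(x,.) are random variables with finite expectations *)
  (forall x, C x -> measurable_fun setT (F x) /\
       P.-integrable setT (fun w => (F x (xi w))%:E)) ->
  (forall i x, C x -> measurable_fun setT (G i x) /\
       P.-integrable setT (fun w => (G i x (xi w))%:E)) ->
  (* stochastic subgradients *)
  (forall x z, C x -> Xi z -> is_subgradient C (fun y => F y z) x (v0 x z)) ->
  (forall i x z, C x -> Xi z -> is_subgradient C (fun y => G i y z) x (v i x z)) ->
  (* (A1) *)
  (forall x y, C x -> C y -> enorm (x - y) <= Rd) ->
  (* (A2) *)
  (forall x z, C x -> Xi z -> Num.sqrt (\sum_(i < p) (G i x z) ^+ 2) <= nu_g) ->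
  (* (A3) *)
  (forall x z, C x -> Xi z -> enorm (v0 x z) <= kappa_f) ->
  (forall i x z, C x -> Xi z -> enorm (v i x z) <= kappa_g) ->
  (* (A4) Slater *)
  0 < eps0 -> C xhat ->
  (forall i, expect P (fun w => G i xhat (xi w)) <= - eps0) ->
  (* (A5) *)
  0 < sigma_c ->
  (forall x i, C x ->
     (\int[P]_w (expR ((G i x (xi w) - expect P (fun w' => G i x (xi w'))) ^+ 2
                        / sigma_c ^+ 2))%:E <= (expR 1)%:E)%E) ->
  (* K > max{1, p kappa_g^2 / 2} *)
  (1 < K)%N -> p%:R * kappa_g ^+ 2 / 2 < K%:R ->
  (* SLPMM run with alpha = sqrt K, sigma = 1/sqrt K *)
  let alpha := Num.sqrt K%:R in
  let sigma := (Num.sqrt K%:R)^-1 in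
  C x0 -> (forall w, xs 0%N w = x0) -> (forall w i, lams 0%N w i = 0) ->
  (forall k w,
     C (xs k.+1 w) /\
     forall y, C y ->
       SLag sigma (F (xs k w) (xis k w)) (v0 (xs k w) (xis k w))
            (fun i => G i (xs k w) (xis k w)) (fun i => v i (xs k w) (xis k w))
            (xs k w) (xs k.+1 w) (lams k w)
       + alpha / 2 * enorm (xs k.+1 w - xs k w) ^+ 2
       <=
       SLag sigma (F (xs k w) (xis k w)) (v0 (xs k w) (xis k w))
            (fun i => G i (xs k w) (xis k w)) (fun i => v i (xs k w) (xis k w))
            (xs k w) y (lams k w)
       + alpha / 2 * enorm (y - xs k w) ^+ 2) ->
  (forall k w i,
     lams k.+1 w i =
     posp (lams k w i + sigma * (G i (xs k w) (xis k w)
                 + dotv (v i (xs k w) (xis k w)) (xs k.+1 w - xs k w)))) ->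
  (* the iterates are random variables adapted to the natural filtration *)
  (forall k (j : 'I_n) (B : set R), measurable B ->
     natural_sigma xis k.+1 ((fun w => xs k.+1 w 0 j) @^-1` B)) ->
  (forall k (i : 'I_p) (B : set R), measurable B ->
     natural_sigma xis k.+1 ((fun w => lams k.+1 w i) @^-1` B)) ->
  let b0 := beta0 p nu_g kappa_g Rd in
  let th1 := theta1 p kappa_g sigma_c b0 eps0 in
  let th2 := theta2 p kappa_f kappa_g Rd eps0 b0 in
  let th3 := theta3 p kappa_g b0 eps0 in
  let th4 := theta4 p nu_g kappa_g eps0 b0 in
  let xbar := fun w => K%:R^-1 *: \sum_(k < K) xs k w in
  forall (rho : R) (i : 'I_p), 0 <= rho ->
    ((1 - expR (- (rho ^+ 2) / 3) - expR (- rho))%:E <=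
     P [set w | (expect P (fun w' => G i (xbar w) (xi w')) <=
                (th1 * rho + th2 + th3 * ln (K%:R + 1)) / Num.sqrt K%:R
                + th4 / K%:R)%R])%E.
Proof.
move=> C0 cptC cC mXi mxi PXi mxis idd indep cvxF cvxG mF mG sgF sgG A1 A2 A3f A3g
  e0 Cxh slater sc0 A5 K1 pK alpha sigma Cx0 xs0 lams0 xs_min lamsE mxs mlams
  b0 th1 th2 th3 th4 xbar rho i rho0.

(* Reduction to bounded constraints and adapted iterates *)
set S := Num.sqrt K%:R in alpha sigma xs_min lamsE *.
have K0 : (0 < K)%N by exact: ltn_trans K1.
have S2 : S ^+ 2 = K%:R by rewrite sqr_sqrtr.
have S1 : 1 <= S by rewrite -sqrtr1 ler_sqrt // ler1n.
have S0 : 0 < S by apply: lt_le_trans S1.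
have Cxs k w : C (xs k w) by case: k => [|k]; [rewrite xs0|have [] := xs_min k w].
pose X : {RV P >-> q.-tuple R} := HB.pack xi (isMeasurableFun.Build _ _ _ _ xi mxi).
pose Q : probability (q.-tuple R) R := distribution P X.
(* The assumptions bound [G] only over the support. Extension by 0 makes the bound, convexity and
   continuity hold for every sample value without changing expectations. *)
pose Gt j u z := if z \in Xi then G j u z else 0.
have GtE j u z : Xi z -> Gt j u z = G j u z by move=> Xz; rewrite /Gt mem_set.
have mGt j u : C u -> measurable_fun setT (Gt j u).
  move=> Cu; have [mGu _] := mG j u Cu.
  rewrite (_ : Gt j u = fun z => G j u z * \1_Xi z).
    by apply: measurable_funM => //; exact: measurable_indic.
  by apply/funext => z; rewrite /Gt indicE; case: ifP; rewrite ?mulr1 ?mulr0.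
have cGt j z : seq_continuous_on C (fun u => Gt j u z).
  rewrite /Gt; case: (boolP (z \in Xi)) => [|_ y u _ _ _]; last exact: cvg_cst.
  by rewrite inE => Xz; apply: within_seq_continuous; have [] := cvxG j z Xz.
have cvGt j z : convex_on C (fun u => Gt j u z).
  rewrite /Gt; case: (boolP (z \in Xi)) => [|_ y u l _ _ _]; last by rewrite !mulr0 addr0.
  by rewrite inE => Xz; have [] := cvxG j z Xz.
have [w0 Xw0] : exists w, Xi (xi w).
  apply: contrapT => nX; have : (1 : \bar R)%E = 0%E.
    rewrite -PXi (_ : xi @^-1` Xi = set0) ?measure0 //.
    by apply/seteqP; split => // w Xw; apply: nX; exists w.
  by move=> /eqP; rewrite onee_eq0.
set a := nu_g in A2 b0 th1 th2 th3 th4 *.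
have kf0 : 0 <= kappa_f by apply: le_trans (A3f _ _ Cxh Xw0); exact: enorm_ge0.
have kg0 : 0 <= kappa_g by apply: le_trans (A3g i _ _ Cxh Xw0); exact: enorm_ge0.
have R0 : 0 <= Rd by apply: le_trans (A1 _ _ Cxh Cxh); exact: enorm_ge0.
have nn : 0 <= a by apply: le_trans (A2 _ _ Cxh Xw0); exact: sqrtr_ge0.
have Gta u z : C u -> Num.sqrt (\sum_j Gt j u z ^+ 2) <= a.
  move=> Cu; rewrite /Gt; case: (boolP (z \in Xi)) => [|_].
    by rewrite inE => Xz; exact: A2.
  by rewrite big1 ?sqrtr0 // => j _; rewrite expr0n.
have Gt_abs j u z : C u -> `|Gt j u z| <= a.
  by move=> Cu; apply: (G_abs_le (C := C) (G := Gt)).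
have gE j u : C u -> fine (\int[Q]_z (Gt j u z)%:E) = expect P (fun w => G j u (xi w)).
  move=> Cu; rewrite /expect /Q; congr fine.
  apply: (@integral_law_support _ _ _ P _ _ X Xi mXi PXi (Gt j u) (G j u) a) => //.
  - exact: mGt.
  - by have [] := mG j u Cu.
  - by move=> z; exact: Gt_abs.
  - by move=> z; exact: GtE.
pose g j u := fine (\int[Q]_z (Gt j u z)%:E).
have hg j u : C u -> `|g j u| <= a.
  by move=> Cu; apply: integral_bounded_le => [|z]; [exact: mGt|exact: Gt_abs].
(* Slater's value is the mean of a quantity bounded by [a] in absolute value. *)
have ea : eps0 <= a.
  have := hg i xhat Cxh; rewrite ler_norml /g gE // => /andP[h _].
  by have := slater i; lra.
have a0 : 0 < a by exact: lt_le_trans ea.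
(* The centred constraints are bounded by [2 * a], so they are also subgaussian with this parameter.
   The cap keeps [8 * t] below [16 * m] and [a / t] at least [1 / 2]. *)
pose t := Num.min sigma_c (2 * a).
have t0 : 0 < t by rewrite lt_min sc0 mulr_gt0.
have tsc : t <= sigma_c by rewrite ge_min lexx.
have ta : t <= 2 * a by rewrite ge_min lexx orbT.
have lawQ k (B : set (q.-tuple R)) : measurable B -> P (xis k @^-1` B) = Q B.
  by move=> mB; exact: idd.
have hGt j u : C u ->
    (\int[Q]_z (expR ((Gt j u z - fine (\int[Q]_z (Gt j u z)%:E)) ^+ 2 / t ^+ 2))%:E
      <= (expR 1)%:E)%E.
  move=> Cu; have mGu := mGt j u Cu.
  have mE c r : measurable_fun setT (fun z => expR ((Gt j u z - c) ^+ 2 / r)).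
    apply: measurableT_comp => //; apply: measurable_funM => //.
    by apply: measurable_funX; exact: measurable_funB.
  have [mD _ _ D2a] := bounded_centered Q mGu (fun z => Gt_abs j u z Cu).
  rewrite /t; case: (leP sigma_c (2 * a)) => _; last first.
    by apply: integral_expR_sqr_bounded; rewrite ?mulr_gt0.
  rewrite gE //; set gu := expect _ _.
  apply: le_trans (A5 u j Cu); rewrite le_eqVlt; apply/orP; left; apply/eqP.
  apply: (@ge0_integral_law_support _ _ _ P _ _ X Xi mXi PXi
    (fun z => (expR ((Gt j u z - gu) ^+ 2 / sigma_c ^+ 2))%:E)
    (fun z => (expR ((G j u z - gu) ^+ 2 / sigma_c ^+ 2))%:E)) => //.
  - apply/measurable_EFinP; exact: mE.
  - have [mGu' _] := mG j u Cu; apply/measurable_EFinP; apply: measurableT_comp => //.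
    apply: measurable_funM => //; apply: measurable_funX; exact: measurable_funB.
  - by move=> z Xz; rewrite GtE.
pose N := \bigcap_k (xis k @^-1` Xi).
have [mN PN] : measurable N /\ P N = 1%E.
  apply: probability_bigcap1 => k; first by rewrite -[X in measurable X]setTI; exact: mxis.
  by rewrite idd.
have xsm k j : measurable_fun (setT : set (past xis k)) (fun w => xs k w 0 j).
  case: k => [|k]; last by move=> _ B mB; rewrite setTI; exact: mxs.
  rewrite (_ : (fun w => _) = cst (x0 0 j)); first exact: measurable_cst.
  by apply/funext => w; rewrite xs0.
have lamsm k j : measurable_fun (setT : set (past xis k)) (fun w => lams k w j).
  case: k => [|k]; last by move=> _ B mB; rewrite setTI; exact: mlams.
  rewrite (_ : (fun w => _) = cst 0); first exact: measurable_cst.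
  by apply/funext => w; rewrite lams0.
have lam_ge0 k w j : 0 <= lams k w j.
  by case: k => [|k]; [rewrite lams0|rewrite lamsE posp_ge0].
have [Cbar cvx_bar] : (forall w, C (xbar w)) /\
   forall w, g i (xbar w) <= K%:R^-1 * \sum_(k < K) g i (xs k w).
  have cg : convex_on C (g i).
    exact: (@g_convex _ _ _ Q _ _ C Gt a mGt Gta i cC (cvGt i)).
  have h w := convex_avg cC cg (fun k => Cxs k w) K0.
  by split=> w; have [] := h w.
pose thr := (th1 * rho + th2 + th3 * ln (K%:R + 1)) / S + th4 / K%:R.
change ((1 - expR (- (rho ^+ 2) / 3) - expR (- rho))%:E <=
  P [set w | (expect P (fun w' => G i (xbar w) (xi w')) <= thr)%R])%E.
have -> : [set w | expect P (fun w' => G i (xbar w) (xi w')) <= thr] =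
    [set w | g i (xbar w) <= thr].
  by apply/seteqP; split => w /=; rewrite -gE.
have ab : a <= b0 by exact: beta0_ge.
have b00 : 0 < b0 by exact: lt_le_trans ab.
pose m := b0 ^+ 2 / eps0.
have bm : b0 <= m.
  by rewrite ler_pdivlMr // expr2 ler_wpM2l ?(ltW b00) // (le_trans ea).
have m0 : 0 < m by exact: lt_le_trans bm.
have tsc' : 0 <= t <= sigma_c by rewrite (ltW t0).
(* In the first case the threshold exceeds [a], which bounds [g]. In the second, [S] is at least 48
   and [rho] is at most [S * (a / t)]. *)
have [triv|nontriv] := leP (a * S) (t * rho + 48 * m).
  have -> : [set w | g i (xbar w) <= thr] = setT.
    apply/seteqP; split=> // w _ /=; apply: le_trans (ler_norm _) _.
    apply: le_trans (hg i _ (Cbar w)) _.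
    have := threshold_ge_trivial p e0 ea kf0 kg0 R0 S1 rho0 tsc'.
    rewrite S2; apply: le_trans; rewrite ler_pdivlMr //.
  rewrite probability_setT lee_fin.
  by have := expR_ge0 (- (rho ^+ 2) / 3); have := expR_ge0 (- rho); lra.
have S48 : 48 <= S.
  rewrite -(ler_pM2l a0) mulrC; apply: ltW; apply: le_lt_trans nontriv.
  by have := mulr_ge0 (ltW t0) rho0; lra.
pose c0 := kappa_f * Rd + S^-1 * a ^+ 2 / 2.
pose l2 := 2 * c0 / eps0 + Rd + 2 * a.
pose th := eps0 * S / (8 * a * t).
pose c := (S * t)^-1.
pose pot := potential xs lams xhat.
pose nz := noise xis Q xs Gt i.
pose q1 := expR (- (th * (32 * m))).
pose q2 := expR (- (rho + 6)).
pose A k w := expR (th * (pot k w - l2)).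
pose M w := expR (c * \sum_(j < K) nz j w - K%:R * (2 * c ^+ 2 * t ^+ 2)).
pose Y w := q1 * (\sum_(k < K.+1) A k w) + q2 * M w.
have th0 : 0 < th by rewrite divr_gt0 ?mulr_gt0.
have iS0 : 0 < S^-1 by rewrite invr_gt0.
have iS1 : S^-1 <= 1 by rewrite invf_le1.
have SV : S * S^-1 = 1 by rewrite mulfV // lt0r_neq0.
have c00 : 0 < c0 by rewrite ltr_wpDl ?mulr_ge0 // divr_gt0 // mulr_gt0 // exprn_gt0.
have step k w : N w -> pot k.+1 w <= l2 \/
    pot k.+1 w <= pot k w + S^-1 * \sum_j lams k w j / pot k w * (Gt j xhat (xis k w) + eps0 / 2).
  move=> Nw; have Xz : Xi (xis k w) by exact: Nw.
  have [Cx1 xmin] := xs_min k w.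
  have sub j : G j (xs k w) (xis k w) + dotv (v j (xs k w) (xis k w)) (xhat - xs k w)
      <= Gt j xhat (xis k w) by rewrite GtE //; exact: sgG.
  have hd := slpmm_drift cC iS0 S0 Cx1 xmin (lamsE k w) (A3f _ _ (Cxs k w) Xz) Cxh sub
    (Gta _ _ Cxh) (A1 _ _ Cxh Cx1).
  rewrite SV !mul1r in hd.
  apply: (potential_step e0 ea _ c00 R0 _ (lam_ge0 k w) (Gta _ _ Cxh) _ hd).
  - by rewrite iS0.
  - by rewrite enorm_ge0 A1.
  - by rewrite addr_ge0 ?sqr_ge0 // sum_sqr_ge0.
have ths : th * S^-1 * (8 * a * t) <= eps0.
  rewrite le_eqVlt; apply/orP; left; apply/eqP; rewrite /th; field.
  by rewrite !lt0r_neq0.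
have gx j : g j xhat <= - eps0 by rewrite /g gE.
have pot0 w : pot 0%N w <= l2.
  rewrite /pot /potential big1 => [|j _]; last by rewrite lams0 expr0n.
  rewrite add0r sqrtr_sqr ger0_norm ?enorm_ge0 //.
  apply: le_trans (A1 _ _ Cxh (Cxs 0%N w)) _; rewrite /l2.
  have : 0 <= 2 * c0 / eps0 by rewrite divr_ge0 ?mulr_ge0 // ltW.
  by lra.
have hA : forall k, (\int[P]_w (A k w)%:E <= (k.+1%:R)%:E)%E.
  exact: (potential_mgf mxis indep lawQ xsm lamsm lam_ge0 mGt Gta a0 t0 hGt
    mN PN Cxh e0 (ltW th0) (ltW iS0) ths gx pot0 step).
have hM : (\int[P]_w (M w)%:E <= 1)%E.
  exact: (noise_mgf mxis indep lawQ Cxs xsm mGt cGt Gta t0 hGt i c K).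
have mA k : measurable_fun setT (A k).
  apply: (past_measurable_fun mxis (k := k)).
  apply: measurableT_comp => //; apply: measurable_funM => //.
  by apply: measurable_funB => //; exact: measurable_potential.
have mM : measurable_fun setT M.
  apply: (past_measurable_fun mxis (k := K)).
  apply: measurableT_comp => //; apply: measurable_funB => //.
  apply: measurable_funM => //; apply: measurable_sum => j.
  exact: (measurable_noise Q Cxs xsm mGt cGt Gta i (ltn_ord j)).
have A0 k w : 0 <= A k w by exact: expR_ge0.
have mY : measurable_fun setT Y.
  apply: measurable_funD; apply: measurable_funM => //.
  by apply: measurable_sum => k.
have Y0 w : 0 <= Y w.
  by rewrite addr_ge0 // mulr_ge0 ?expR_ge0 // sumr_ge0.
have mS' : measurable [set w | g i (xbar w) <= thr].
  have mg : measurable_fun setT (fun w => g i (xbar w)).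
    apply: (measurable_g Q mGt cGt Gta i Cbar) => j.
    rewrite (_ : (fun w => xbar w 0 j) = fun w => K%:R^-1 * \sum_(k < K) xs k w 0 j).
      apply: measurable_funM => //; apply: measurable_sum => k.
      exact: (past_measurable_fun mxis (xsm k j)).
    by apply/funext => w; rewrite mxE summxE.
  have := mg measurableT _ (measurable_itv `]-oo, thr]); rewrite setTI.
  by congr measurable; apply/seteqP; split => w /=; rewrite in_itv.
have Yb : (\int[P]_w (Y w)%:E <= (expR (- rho))%:E)%E.
  have mAE k : measurable_fun setT (fun w => (A k w)%:E) by exact/measurable_EFinP.
  have q10 : (0 <= q1%:E)%E by rewrite lee_fin expR_ge0.
  have q20 : (0 <= q2%:E)%E by rewrite lee_fin expR_ge0.
  have sA0 w : (0 <= \sum_(k < K.+1) (A k w)%:E)%E.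
    by apply: sume_ge0 => k _; rewrite lee_fin.
  have msA : measurable_fun setT (fun w => \sum_(k < K.+1) (A k w)%:E)%E.
    by apply: emeasurable_sum => k; exact: mAE.
  have mME : measurable_fun setT (fun w => (M w)%:E) by exact/measurable_EFinP.
  under eq_integral => w _ do rewrite /Y EFinD !EFinM -sumEFin.
  rewrite ge0_integralD //; last 4 first.
  - by move=> w _; rewrite mule_ge0.
  - by apply: emeasurable_funM => //; exact: measurable_cst.
  - by move=> w _; rewrite mule_ge0 // lee_fin expR_ge0.
  - by apply: emeasurable_funM => //; exact: measurable_cst.
  rewrite ge0_integralZl // ge0_integralZl //; last by move=> w _; rewrite lee_fin expR_ge0.
  rewrite ge0_integral_sum //; last by move=> k w _; rewrite lee_fin.
  apply: (@le_trans _ _ (q1%:E * \sum_(k < K.+1) (k.+1%:R)%:E + q2%:E * 1)%E).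
    by apply: leeD; rewrite lee_wpmul2l //; apply: lee_sum => k _.
  rewrite mule1 sumEFin -EFinM -EFinD lee_fin.
  have half : expR (-1) <= 2^-1 :> R.
    by rewrite expRN lef_pV2 ?posrE ?expR_gt0 //; have := expR_ge1Dx (1 : R); lra.
  (* A crude count of all potentials by [(K + 1) ^ 2], which [48 <= S] absorbs into [expR S]. *)
  have sumK : \sum_(k < K.+1) k.+1%:R <= expR S.
    apply: (@le_trans _ _ (\sum_(k < K.+1) K.+1%:R)).
      by apply: ler_sum => k _; rewrite ler_nat.
    have -> : \sum_(k < K.+1) K.+1%:R = (S ^+ 2 + 1) ^+ 2.
      by rewrite S2 natr1 sumr_const card_ord expr2 mulr_natr.
    have -> : expR S = expR (S / 2) ^+ 2 by rewrite expr2 -expRD; congr expR; field.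
    rewrite ler_sqr ?nnegrE ?expR_ge0 ?addr_ge0 ?sqr_ge0 //.
    exact: sqrD1_le_expR.
  have ratio : 1 <= 2 * (a / t) by rewrite mulrA ler_pdivlMr // mul1r.
  have rhoS : rho <= S * (a / t).
    rewrite mulrA ler_pdivlMr //; move: nontriv; lra.
  (* Of the four multiples of [S * (a / t)], one pays for [rho], two for the factor [expR S], and
     the last for [expR (-1)]. *)
  have thm : 4 * (S * (a / t)) <= th * (32 * m).
    have -> : th * (32 * m) = 4 * (S * (b0 ^+ 2 / (a * t))).
      by rewrite /th /m; field; rewrite !lt0r_neq0.
    rewrite !ler_pM2l // ler_pdivlMr ?mulr_gt0 //.
    have -> : a / t * (a * t) = a ^+ 2 by field; rewrite lt0r_neq0.
    by rewrite ler_sqr ?nnegrE // ltW.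
  have Sr : S <= 2 * (S * (a / t)).
    by rewrite mulrCA ler_peMr // ltW.
  have e1 : q1 * \sum_(k < K.+1) k.+1%:R <= expR (- rho) * expR (-1).
    apply: (@le_trans _ _ (q1 * expR S)); first by rewrite ler_wpM2l ?expR_ge0.
    by rewrite -!expRD ler_expR; lra.
  have e2 : q2 <= expR (- rho) * expR (-1).
    by rewrite -expRD ler_expR; lra.
  have := ler_wpM2l (expR_ge0 (- rho)) half; lra.
apply: le_trans (markov_full mN PN mS' mY Y0 Yb _).
  by rewrite lee_fin; have := expR_ge0 (- (rho ^+ 2) / 3); lra.

(* Pathwise bound on the event where [Y] is less than 1 *)
move=> w Nw Y1 /=.
have Xw k : Xi (xis k w) by exact: Nw.
pose L := l2 + 32 * m.
have potL k : (k <= K)%N -> pot k w <= L.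
  move=> kK; have : q1 * A k w < 1.
    apply: le_lt_trans Y1; rewrite /Y (bigD1 (Ordinal (n := K.+1) (m := k) kK)) //=.
    rewrite mulrDr -addrA lerDl; apply: addr_ge0; apply: mulr_ge0; try exact: expR_ge0.
    by apply: sumr_ge0 => j _; exact: expR_ge0.
  rewrite -expRD expR_lt1.
  have -> : - (th * (32 * m)) + th * (pot k w - l2) = th * (pot k w - L) by rewrite /L; ring.
  by rewrite pmulr_rlt0 // subr_lt0 => /ltW.
(* The 8 is the 6 of [q2] plus the total discount 2. *)
have nzS : \sum_(j < K) nz j w <= S * t * (rho + 8).
  have : q2 * M w < 1.
    apply: le_lt_trans Y1; rewrite /Y lerDr; apply: mulr_ge0; first exact: expR_ge0.
    by apply: sumr_ge0 => j _; exact: expR_ge0.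
  rewrite -expRD expR_lt1.
  have -> : K%:R * (2 * c ^+ 2 * t ^+ 2) = 2.
    by rewrite -S2 /c; field; rewrite !lt0r_neq0.
  move=> h; have St : 0 < S * t by rewrite mulr_gt0.
  by rewrite -ler_pdivrMl //; rewrite -/c; lra.
have sumG : \sum_(j < K) Gt i (xs j w) (xis j w) <=
    S * (L + kappa_g * kappa_f + kappa_g * (Num.sqrt p%:R * kappa_g) * L)
    + kappa_g * (Num.sqrt p%:R * kappa_g) * a.
  have lamL j : (j <= K)%N -> Num.sqrt (\sum_l lams j w l ^+ 2) <= L.
    move=> jK; apply: le_trans (potL j jK); rewrite ler_sqrt ?lerDl ?sqr_ge0 //.
    by rewrite addr_ge0 ?sqr_ge0 // sum_sqr_ge0.
  have GkE j : Num.sqrt (\sum_l G l (xs j w) (xis j w) ^+ 2) <= a by exact: A2.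
  apply: (@sum_constraint_le _ K S kappa_f kappa_g (Num.sqrt p%:R * kappa_g) a L
    (fun j => Gt i (xs j w) (xis j w)) (fun j => lams j w i)
    (fun j => enorm (xs j.+1 w - xs j w))
    (fun j => Num.sqrt (\sum_l lams j w l ^+ 2))) => //.
  - by rewrite mulr_ge0 ?sqrtr_ge0.
  - move=> j _; rewrite GtE //.
    have := posp_ge (lams j w i + sigma * (G i (xs j w) (xis j w) +
      dotv (v i (xs j w) (xis j w)) (xs j.+1 w - xs j w))).
    rewrite -lamsE /sigma; set D := dotv _ _; set e := enorm _.
    have hD : - (kappa_g * e) <= D.
      apply: le_trans (dotv_ge _ _); rewrite lerN2 ler_wpM2r ?enorm_ge0 //; exact: A3g.
    move/(ler_wpM2l (ltW S0)); rewrite mulrDr mulrA SV mul1r mulrBr; lra.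
  - move=> j _; have [Cx1 xmin] := xs_min j w.
    exact: (slpmm_increment cC iS0 S0 Cx1 xmin kg0 (A3f _ _ (Cxs j w) (Xw j))
      (fun l => A3g l _ _ (Cxs j w) (Xw j)) (GkE j) (Cxs j w)).
  - by move=> j jK; apply: lamL; exact: ltnW.
  - apply: le_trans (lamL K (leqnn K)).
    rewrite -[leLHS]ger0_norm // -sqrtr_sqr ler_sqrt ?sum_sqr_ge0 //.
    by rewrite (bigD1 i) //= lerDl sumr_ge0 // => l _; exact: sqr_ge0.
apply: le_trans (cvx_bar w) _.
have -> : \sum_(k < K) g i (xs k w) =
    \sum_(j < K) nz j w + \sum_(j < K) Gt i (xs j w) (xis j w).
  by rewrite -big_split; apply: eq_bigr => j _; rewrite /= /nz /noise subrK.
have := @threshold_ge R p a kappa_f kappa_g Rd eps0 sigma_c e0 ea kg0 R0 S rho t S1 rho0 tsc'.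
rewrite -/b0 -/m -/c0 -/th1 -/th2 -/th3 -/th4.
rewrite (_ : 2 * c0 / eps0 + Rd + 2 * a + 32 * m = L) // S2 -/thr.
apply: le_trans.
(* The surplus in [threshold_ge] is nonnegative because [t <= 2 * a <= 2 * m]. *)
have h8 : 0 <= (16 * m - 8 * t) / S.
  by rewrite divr_ge0 // ?(ltW S0) //; lra.
have := lerD nzS sumG.
have KV : 0 < K%:R^-1 :> R by rewrite invr_gt0 ltr0n.
move/(ler_wpM2l (ltW KV)) => hh; apply: (le_trans hh).
rewrite -subr_ge0; apply: le_trans h8 _.
rewrite le_eqVlt; apply/orP; left; apply/eqP.
by rewrite -S2; field; rewrite lt0r_neq0.
Qed.
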